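(* Let $G$ be a group with a proper, cocompact, and growth tight action on a connected graph $\Upsilon$. Assume also that $G$ has a weakly properly discontinuous (WPD) action on a hyperbolic space $X$. Suppose that $H\subset G$ is a subgroup whose action on $X$ is elliptic. Then the growth rate of $H$ for $\Upsilon$ is strictly smaller than the growth rate of $G$: $$\lambda_H(\Upsilon) < \lambda_G(\Upsilon).$$
   Context: All actions are by isometries; $\Upsilon$ carries its graph metric $d_\Upsilon$ (edges of length $1$), and hyperbolic means Gromov hyperbolic. The action on $\Upsilon$ is proper if for every vertex $b$ and $r\ge0$ the set $\{g\in G: d_\Upsilon(b,gb)\le r\}$ is finite, and cocompact if there are finitely many orbits of vertices and edges. Growth rates: if a group $G$ acts properly and cocompactly on a graph $\Upsilon$ with basepoint $b$, then for a subset $H\subset G$ let $f_{H,\Upsilon}(n)=\#\{h\in H: d_\Upsilon(b,h(b))\le n\}$ and $\lambda_H(\Upsilon)=\limsup_{n\to\infty}\sqrt[n]{f_{H,\Upsilon}(n)}$; this does not depend on $b$. Growth tight: one may assume $G$ acts on $\Upsilon$ without inverting edges (if $G$ inverts an edge, add a second copy of that edge, without changing distances). For a normal subgroup $N$, the group $G/N$ acts properly and cocompactly on the quotient graph $N\backslash\Upsilon$. The action of $G$ on $\Upsilon$ is growth tight if for every infinite normal subgroup $N$ of $G$ one has $\lambda_{G/N}(N\backslash\Upsilon)<\lambda_G(\Upsilon)$. WPD: an isometric action of $G$ on a hyperbolic metric space $X$ with metric $d$ is weakly properly discontinuous if (1) $G$ is non-elementary (contains no cyclic subgroup of finite index); (2)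 $G$ contains at least one element acting loxodromically on $X$; and (3) for every loxodromic $g\in G$, every $x\in X$ and every $r>0$ there exists $n>0$ such that the set $\{\gamma\in G : d(x,\gamma x)\le r,\ d(g^n x,\gamma g^n x)\le r\}$ is finite. The action of a subgroup $H\subset G$ on $X$ is elliptic if some orbit $Hx\subset X$ is bounded. *)

(* Defs.v *)
From HB Require Import structures.
From mathcomp Require Import all_boot all_order all_algebra finmap.
From mathcomp Require Import all_classical all_reals.
From mathcomp Require Import ereal topology normedtype sequences exp.

Set Implicit Arguments.
Unset Strict Implicit.
Unset Printing Implicit Defensive.

Import Order.TTheory GRing.Theory Num.Theory.

Local Open Scope classical_set_scope.
Local Open Scope quotient_scope.
Local Open Scope group_scope.

Definition subgroup (G : groupType) (H : set G) : Prop :=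
  [/\ H 1, forall g h, H g -> H h -> H (g * h) & forall g, H g -> H g^-1].

Record normal_subgroup (G : groupType) := NormalSubgroup {
  normal_set : set G;
  normal_subgroupP : subgroup normal_set;
  normal_conj : forall g k, normal_set k -> normal_set (g * k * g^-1) }.

Definition coset_rel (G : groupType) (N : normal_subgroup G) : rel G :=
  fun g h => `[< normal_set N (g^-1 * h) >].

Section Quotient.
Variables (G : groupType) (N : normal_subgroup G).

Let N1 : normal_set N 1. Proof. by case: (normal_subgroupP N). Qed.
Let NM g h : normal_set N g -> normal_set N h -> normal_set N (g * h).
Proof. by case: (normal_subgroupP N) => _ + _; apply. Qed.
Let NV g : normal_set N g -> normal_set N g^-1.
Proof. by case: (normal_subgroupP N) => _ _; apply. Qed.

Lemma coset_rel_equiv : equiv_class_of (coset_rel N).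
Proof.
split.
- by move=> g; apply/asboolP; rewrite mulVg.
- move=> g h; apply/asboolP/asboolP => /NV; by rewrite invgM invgK.
- move=> h g k /asboolP gh /asboolP hk; apply/asboolP.
  by have := NM gh hk; rewrite -mulgA mulVKg.
Qed.

Canonical coset_equiv := EquivRelPack coset_rel_equiv.

Definition quotient : Type := {eq_quot (coset_rel N)}.

HB.instance Definition _ := Choice.on quotient.
HB.instance Definition _ := Quotient.on quotient.
HB.instance Definition _ := EqQuotient.on quotient.

Lemma quotientP (g h : G) :
  \pi_quotient g = \pi_quotient h <-> normal_set N (g^-1 * h).
Proof.
split=> [/eqP|gh]; first by rewrite eqmodE => /asboolP.
by apply/eqP; rewrite eqmodE; apply/asboolP.
Qed.

Definition quotient_mul (p q : quotient) : quotient :=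
  \pi_quotient (repr p * repr q).
Definition quotient_inv (p : quotient) : quotient := \pi_quotient (repr p)^-1.
Definition quotient_one : quotient := \pi_quotient (1 : G).

Lemma repr_quotient (g : G) : exists2 k, normal_set N k & repr (\pi_quotient g) = g * k.
Proof.
exists (g^-1 * repr (\pi_quotient g)); last by rewrite mulVKg.
by apply/quotientP; rewrite reprK.
Qed.

Lemma pi_quotient_mul (g h : G) :
  quotient_mul (\pi g) (\pi h) = \pi_quotient (g * h).
Proof.
have [k Nk ek] := repr_quotient g; have [l Nl el] := repr_quotient h.
apply/esym/quotientP; rewrite ek el invgM.
have -> : h^-1 * g^-1 * (g * k * (h * l)) = h^-1 * k * h * l.
  by rewrite !mulgA mulgVK.
by apply: NM => //; have := normal_conj h^-1 Nk; rewrite invgK.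
Qed.

Lemma pi_quotient_inv (g : G) :
  quotient_inv (\pi g) = \pi_quotient g^-1.
Proof.
have [k Nk ek] := repr_quotient g.
by apply/quotientP; rewrite ek invgK; apply: normal_conj.
Qed.

Let qmulA : associative quotient_mul.
Proof.
by elim/quotW=> x; elim/quotW=> y; elim/quotW=> z; rewrite !pi_quotient_mul mulgA.
Qed.
Let qmul1 : left_id quotient_one quotient_mul.
Proof. by elim/quotW=> x; rewrite pi_quotient_mul mul1g. Qed.
Let qmulr1 : right_id quotient_one quotient_mul.
Proof. by elim/quotW=> x; rewrite pi_quotient_mul mulg1. Qed.
Let qmulV : left_inverse quotient_one quotient_inv quotient_mul.
Proof. by elim/quotW=> x; rewrite pi_quotient_inv pi_quotient_mul mulVg. Qed.
Let qmulrV : right_inverse quotient_one quotient_inv quotient_mul.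
Proof. by elim/quotW=> x; rewrite pi_quotient_inv pi_quotient_mul mulgV. Qed.

HB.instance Definition _ := isGroup.Build quotient
  qmulA qmul1 qmulr1 qmulV qmulrV.

End Quotient.

Definition expgz (G : groupType) (g : G) (z : int) : G :=
  match z with Posz n => g ^+ n | Negz n => g ^- n.+1 end.

Definition cyclic_subgroup (G : groupType) (g : G) : set G := range (expgz g).

Definition finite_index (G : groupType) (K : set G) : Prop :=
  finite_set (range (fun g : G => [set g * k | k in K])).

Definition non_elementary (G : groupType) : Prop :=
  forall g : G, ~ finite_index (cyclic_subgroup g).

Record group_action (G : groupType) (T : Type) := GroupAction {
  act_fun :> G -> T -> T;
  act1 : forall x, act_fun 1 x = x;
  actM : forall g h x, act_fun (g * h) x = act_fun g (act_fun h x) }.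

Definition act_orbit (G : groupType) (T : Type) (a : group_action G T)
  (K : set G) (x : T) : set T := [set a k x | k in K].

Definition orbit_rel (G : groupType) (T : Type) (a : group_action G T)
  (N : normal_subgroup G) : rel T := fun x y => `[< act_orbit a (normal_set N) x y >].

Section OrbitSpace.
Variables (G : groupType) (T : choiceType) (a : group_action G T).
Variable N : normal_subgroup G.

Let N1 : normal_set N 1. Proof. by case: (normal_subgroupP N). Qed.
Let NM g h : normal_set N g -> normal_set N h -> normal_set N (g * h).
Proof. by case: (normal_subgroupP N) => _ + _; apply. Qed.
Let NV g : normal_set N g -> normal_set N g^-1.
Proof. by case: (normal_subgroupP N) => _ _; apply. Qed.

Lemma orbit_rel_equiv : equiv_class_of (orbit_rel a N).
Proof.
have sym x y : act_orbit a (normal_set N) x y -> act_orbit a (normal_set N) y x.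
  by move=> [k Nk <-]; exists k^-1; [exact: NV | rewrite -actM mulVg act1].
split.
- by move=> x; apply/asboolP; exists 1 => //; rewrite act1.
- by move=> x y; apply/asboolP/asboolP; exact: sym.
- move=> y x z /asboolP[k Nk <-] /asboolP[l Nl <-]; apply/asboolP.
  by exists (l * k); [exact: NM | rewrite actM].
Qed.

Canonical orbit_equiv := EquivRelPack orbit_rel_equiv.

Definition orbit_space : Type := {eq_quot (orbit_rel a N)}.

HB.instance Definition _ := Choice.on orbit_space.
HB.instance Definition _ := Quotient.on orbit_space.
HB.instance Definition _ := EqQuotient.on orbit_space.

Lemma orbit_spaceP (x y : T) :
  \pi_orbit_space x = \pi_orbit_space y <-> act_orbit a (normal_set N) x y.
Proof.
split=> [/eqP|gh]; first by rewrite eqmodE => /asboolP.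
by apply/eqP; rewrite eqmodE; apply/asboolP.
Qed.

Definition orbit_space_act (q : quotient N) (o : orbit_space) : orbit_space :=
  \pi_orbit_space (a (repr q) (repr o)).

Lemma pi_orbit_space_act (g : G) (x : T) :
  orbit_space_act (\pi g) (\pi x) = \pi_orbit_space (a g x).
Proof.
have [k Nk ek] := repr_quotient N g.
have [l Nl el] : act_orbit a (normal_set N) x (repr (\pi_orbit_space x)).
  by apply/orbit_spaceP; rewrite reprK.
apply/esym/orbit_spaceP; exists (g * (k * l) * g^-1).
  by apply/normal_conj/NM.
by rewrite ek -el -!actM mulgVK !mulgA.
Qed.

Let oact1 o : orbit_space_act 1 o = o.
Proof. by elim/quotW: o => x; rewrite -[1]/(quotient_one N) pi_orbit_space_act act1. Qed.

Let oactM p q o :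
  orbit_space_act (p * q) o = orbit_space_act p (orbit_space_act q o).
Proof.
elim/quotW: o => x; elim/quotW: p => g; elim/quotW: q => h.
rewrite -[_ * _]/(quotient_mul _ _) pi_quotient_mul.
by rewrite !pi_orbit_space_act actM.
Qed.

(* gN . (N x) = N (g x), see [pi_orbit_space_act]. *)
Definition orbit_space_action : group_action (quotient N) orbit_space :=
  GroupAction oact1 oactM.

End OrbitSpace.

(* Unoriented graphs, with loops and multiple edges allowed: [joins e u v]
   means that {u, v} is the pair of endpoints of e. *)
Record graph := Graph {
  vertex : choiceType;
  edge : choiceType;
  joins : edge -> vertex -> vertex -> Prop;
  joins_ends : forall e, exists u v, forall x y,
    joins e x y <-> (x = u /\ y = v) \/ (x = v /\ y = u) }.

Inductive walk (Y : graph) : nat -> vertex Y -> vertex Y -> Prop :=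
| walk0 u : walk 0 u u
| walkS n e u v w : joins e u v -> walk n v w -> walk n.+1 u w.

Definition connected_graph (Y : graph) : Prop :=
  forall u v : vertex Y, exists n, walk n u v.

(* The graph metric on vertices: least length of a walk from u to v. The value
   is a dummy 0 if there is none, which does not occur in connected graphs. *)
Definition gdist (Y : graph) (u v : vertex Y) : nat :=
  match pselect (exists n, `[< walk n u v >]) with
  | left h => ex_minn h
  | right _ => 0%N
  end.

Record graph_action (G : groupType) (Y : graph) := GraphAction {
  on_vertex :> group_action G (vertex Y);
  on_edge : group_action G (edge Y);
  joins_act : forall g e u v,
    joins e u v -> joins (on_edge g e) (on_vertex g u) (on_vertex g v) }.

(* [gdist] takes values in nat, so it is enough to consider radii in nat. *)
Definition proper_action (G : groupType) (Y : graph) (a : graph_action G Y) :=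
  forall (b : vertex Y) (r : nat), finite_set [set g | (gdist b (a g b) <= r)%N].

Definition cocompact_action (G : groupType) (Y : graph)
    (a : graph_action G Y) :=
  finite_set (range (act_orbit (on_vertex a) setT)) /\
  finite_set (range (act_orbit (on_edge a) setT)).

Section QuotientGraph.
Variables (G : groupType) (Y : graph) (a : graph_action G Y).
Variable N : normal_subgroup G.

Let V := orbit_space (on_vertex a) N.
Let E := orbit_space (on_edge a) N.

Definition quotient_joins (e : E) (u v : V) : Prop :=
  exists e' u' v', [/\ \pi_E e' = e, \pi_V u' = u, \pi_V v' = v & joins e' u' v'].

Lemma quotient_joins_ends e : exists u v, forall x y,
  quotient_joins e x y <-> (x = u /\ y = v) \/ (x = v /\ y = u).
Proof.
elim/quotW: e => e; have [u [v uv]] := joins_ends e.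
exists (\pi_V u), (\pi_V v) => x y; split.
- move=> [e' [x' [y' [/esym/orbit_spaceP[k Nk <-] <- <-]]]].
  move=> /(joins_act a k^-1); rewrite -!actM mulVg act1 => /uv.
  have piV z : \pi_V z = \pi_V (a k^-1 z).
    apply/orbit_spaceP; exists k^-1 => //.
    by case: (normal_subgroupP N) => _ _; apply.
  by rewrite (piV x') (piV y') => -[] [-> ->]; [left|right].
- by case=> -[-> ->]; [exists e, u, v | exists e, v, u]; split=> //; apply/uv;
    [left|right].
Qed.

(* The graph N\Y. An edge inverted by an element of N becomes a loop, exactly
   as it does after doubling the inverted edges of Y. *)
Definition quotient_graph : graph := Graph quotient_joins_ends.

Let quotient_joins_act (q : quotient N) (e : E) (u v : V) :
  @joins quotient_graph e u v ->
  @joins quotient_graph (orbit_space_action (on_edge a) N q e)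
        (orbit_space_action (on_vertex a) N q u)
        (orbit_space_action (on_vertex a) N q v).
Proof.
elim/quotW: q => g [e' [u' [v' [<- <- <- uv]]]].
exists (on_edge a g e'), (a g u'), (a g v').
by split; rewrite /= ?pi_orbit_space_act //; apply: joins_act.
Qed.

Definition quotient_action : graph_action (quotient N) quotient_graph :=
  @GraphAction _ quotient_graph (orbit_space_action (on_vertex a) N)
    (orbit_space_action (on_edge a) N) quotient_joins_act.

Definition quotient_vertex (b : vertex Y) : vertex quotient_graph := \pi_V b.

End QuotientGraph.

(* [fset_set A] is a dummy empty set when A is infinite; for proper actions the
   sets counted here are finite. *)
Definition growth_function (G : groupType) (Y : graph) (a : graph_action G Y)
    (b : vertex Y) (H : set G) (n : nat) : nat :=
  #|` fset_set [set h | H h /\ (gdist b (a h b) <= n)%N]|%fset.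

Definition growth_rate (R : realType) (G : groupType) (Y : graph)
    (a : graph_action G Y) (b : vertex Y) (H : set G) : \bar R :=
  limn_esup (fun n : nat =>
    (((growth_function a b H n)%:R : R) `^ (n%:R)^-1)%R%:E).

Definition growth_tight (R : realType) (G : groupType) (Y : graph)
    (a : graph_action G Y) : Prop :=
  forall N : normal_subgroup G, infinite_set (normal_set N) -> forall b : vertex Y,
    (growth_rate R (quotient_action a N) (quotient_vertex a N b) setT
       < growth_rate R a b setT)%E.

Local Open Scope ring_scope.

Definition gromov_product (R : realType) (X : metricType R) (w x y : X) : R :=
  (mdist x w + mdist y w - mdist x y) / 2.

Definition gromov_hyperbolic (R : realType) (X : metricType R) : Prop :=
  exists2 delta : R, 0 <= delta & forall w x y z : X,
    Num.min (gromov_product w x y) (gromov_product w y z) - delta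
      <= gromov_product w x z.

Record isometric_action (G : groupType) (R : realType) (X : metricType R) :=
  IsometricAction {
    isom_action :> group_action G X;
    isom_actP : forall g (x y : X),
      mdist (isom_action g x) (isom_action g y) = mdist x y }.

(* g is loxodromic if n |-> g^n x is a quasi-isometric embedding of Z in X for
   some (equivalently, every) point x. *)
Definition loxodromic (G : groupType) (R : realType) (X : metricType R)
    (a : isometric_action G X) (g : G) : Prop :=
  exists (x : X) (L C : R), [/\ 1 <= L, 0 <= C & forall m n : int,
    L^-1 * `|(m - n)%:~R| - C <= mdist (a (expgz g m) x) (a (expgz g n) x)
      <= L * `|(m - n)%:~R| + C].

Definition wpd (G : groupType) (R : realType) (X : metricType R)
    (a : isometric_action G X) : Prop :=
  [/\ non_elementary G,
      exists g, loxodromic a g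
    & forall g, loxodromic a g -> forall (x : X) (r : R), 0 < r ->
        exists2 n : nat, (0 < n)%N &
          finite_set [set h | mdist x (a h x) <= r /\
            mdist (a (g ^+ n)%g x) (a h (a (g ^+ n)%g x)) <= r]].

Definition elliptic (G : groupType) (R : realType) (X : metricType R)
    (a : isometric_action G X) (H : set G) : Prop :=
  exists x : X, exists M : R, forall y z : X,
    act_orbit a H x y -> act_orbit a H x z -> mdist y z <= M.

(* Main.v *)
Require Import Defs.
From HB Require Import structures.
From mathcomp Require Import all_boot all_order all_algebra finmap.
From mathcomp Require Import all_classical all_reals.
From mathcomp Require Import ereal topology normedtype sequences exp.
From mathcomp Require Import lra ring zify.

Set Implicit Arguments.
Unset Strict Implicit.
Unset Printing Implicit Defensive.

Import Order.TTheory GRing.Theory Num.Theory.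

Local Open Scope classical_set_scope.
Local Open Scope ring_scope.

(** Strict inequality of growth rates for elliptic subgroups.

    It suffices to find an infinite normal subgroup N of G that meets H
    trivially.  Then H embeds in G/N, and since the projection to the quotient
    graph does not increase distances, the balls of H are no larger than those
    of G/N; growth tightness concludes ([growth_function_quotient] and the final
    proof).

    As H has an orbit of diameter at most M, N meets H trivially as soon as every
    nontrivial element of N moves a given point by more than M.  N is taken to be
    the normal closure of a large power of a loxodromic element, and the
    displacement bound is a small cancellation phenomenon
    ([wpd_normal_subgroup]).

    Geometry.  The space X need not be geodesic, so everything is phrased with
    the four-point inequality.  Nearest-point projection to a quasi-convex set A
    is replaced by the pseudo-metric [proj_dist A], which is 1-Lipschitz,
    satisfies an exact triangle inequality and is equivariant.  If it separates x
    from y, then every path from x to y essentially runs along A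
    ([proj_dist_through]); Behrstock's inequality follows at once
    ([behrstock]).

    Spinning.  Suppose that an invariant family of axes has pairwise bounded
    projections and that each axis carries a group of translations of minimal
    length about Lam ([spinning_family]).  The group generated by all these
    rotations is exhausted by the subgroups [level i] generated by the rotations
    about axes at distance less than i T from the base point p.  An element of
    level i + 1 is a product of elements of level i and of rotations about new
    axes, those that no element of level i brings closer.  In a reduced such
    product the new axes appear as a chain of pivots, each of them crossed over a
    length of about Lam, so that Behrstock's inequality propagates along the
    chain ([chain_forward], [chain_backward], [chain_large]).  For this one needs
    that a new axis sees the orbit of p under level i under a small angle.  Each
    level may increase that angle by a bounded amount (level_proj), but the
    increase never accumulates for more than about Lam / T levels: the orbit of
    level i is coarsely convex up to the scale i T + Lam (level_convex), hence an
    axis much farther away sees it under an angle independent of Lam.  Both facts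
    are proved simultaneously in [level_step]; the gain over the linear loss comes
    from taking T much larger than the hyperbolicity constants and Lam much
    larger than T ([spinning_displacement]).

    WPD.  A suitable power gam of a loxodromic element has a quasi-geodesic orbit
    with good constants ([displacement_superadditive], [axis_gated]).  If a
    translate of its axis fellow-travels the axis for a long time, then weak
    proper discontinuity and the pigeonhole principle show that the translating
    element conjugates a fixed power gam^m to itself or its inverse
    ([wpd_parallel]).  The elements with this property stabilize the axis, all
    other translates have bounded projection to it, and the conjugates of
    the powers of gam^L, with L a large multiple of m, form a spinning family
    ([axis_spinning_family]). *)

(** * Four-point hyperbolicity and projections to quasi-convex sets *)

Section HyperbolicGeometry.
Variables (R : realType) (X : metricType R).
Implicit Types (x y z u v w : X) (A : set X).
Local Notation d := (@mdist R X).

(** Twice the Gromov product of x and y at z. *)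
Definition detour x z y : R := d x z + d z y - d x y.

Lemma detour_sym x z y : detour x z y = detour y z x.
Proof.
rewrite /detour (metric_sym x z) (metric_sym z y) (metric_sym x y); lra.
Qed.

Definition four_point (delta : R) : Prop := forall x y z w,
  d x z + d y w <= d x y + d z w + 2 * delta \/
  d x z + d y w <= d y z + d x w + 2 * delta.

Lemma hyperbolic_four_point : gromov_hyperbolic X ->
  exists2 delta : R, 0 <= delta & four_point delta.
Proof.
case=> delta delta0 hyp; exists delta => // x y z w.
have := hyp w x y z.
have := metric_sym y w; have := metric_sym z w; have := metric_sym x w.
by case: (leP (gromov_product w x y)) => _ h1 h2 h3; rewrite /gromov_product;
  [left|right]; lra.
Qed.

Section FourPoint.
Variables (delta : R) (hyp : four_point delta).

(** The hyperbolicity inequality for Gromov products at z: if x and w are joined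
    close to z, then so are x and y, or y and w. *)
Lemma detour_insert x y w z :
  detour x z y <= detour x z w + 2 * delta \/
  detour y z w <= detour x z w + 2 * delta.
Proof.
rewrite /detour; have := metric_sym z y; have := metric_sym z x.
by have := metric_sym z w; case: (hyp x y w z); [left|right]; lra.
Qed.

(** Inserting the points of a chain one after the other in [detour_insert] would
    cost 2 delta for each of them.  Since all of them lie near the path from w 0
    to w n, the cost is uniform: for the first index l + 1 such that z is near the
    path from w 0 to w (l + 1), z is also near the path from w l to w n, so it is
    near the piece between w l and w (l + 1) or near w l itself. *)
Lemma detour_chain (w : nat -> X) n z (q e : R) : 0 <= e -> 0 <= delta ->
  (forall l, (l <= n)%N -> detour (w 0%N) (w l) (w n) <= e) ->
  (0 < n)%N -> detour (w 0%N) z (w n) <= q ->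
  exists2 l, (l < n)%N & detour (w l) z (w l.+1) <= q + e + 6 * delta.
Proof.
move=> e0 delta0 we n0 zq.
have ex : exists l, detour (w 0%N) z (w l) <= q + 2 * delta by exists n; lra.
case: (ex_minnP ex) => -[|l] zl lmin.
  exists 0%N => //; move: zl; rewrite /detour mdistxx (metric_sym z (w 0%N)) => zl.
  by have := metric_triangle z (w 0%N) (w 1%N); have := metric_sym z (w 0%N); lra.
have ln : (l < n)%N by apply: (lmin n); lra.
have /negP : ~~ (detour (w 0%N) z (w l) <= q + 2 * delta).
  by apply/negP => /lmin; rewrite ltnn.
move=> /negP; rewrite -ltNge => zl'; exists l => //.
have zn : detour (w l) z (w n) <= q + 2 * delta.
  by case: (detour_insert (w 0%N) (w l) (w n) z); lra.
case: (detour_insert (w 0%N) (w l) (w l.+1) z) => h; last lra.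
(* Here z lies near both halves of the path, hence near the point w l. *)
have close : 2 * d z (w l) <= q + e + 6 * delta.
  have := we l (ltnW ln); case: (detour_insert (w 0%N) z (w n) (w l));
  by move: h zn zl; rewrite /detour (metric_sym (w l) z); lra.
rewrite /detour; have := metric_triangle z (w l) (w l.+1).
by have := metric_sym z (w l); lra.
Qed.

End FourPoint.

(** A coarse nearest point of x in A: paths from x to A pass near it.  In a
    hyperbolic space gates exist for quasi-convex A, and having gates is all that
    is used of quasi-convexity. *)
Definition gate A (c : R) x x' : Prop :=
  A x' /\ forall u, A u -> d x x' + d x' u <= d x u + c.

Definition gated (c : R) A : Prop := forall x, exists x', gate A c x x'.

(** In a tree with A convex this is the distance of the nearest-point projections
    of x and y to A.  Written as a supremum of cross differences it depends on no
    choice of projections, so that the triangle inequality, the Lipschitz property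
    and equivariance hold without error terms. *)
Definition proj_dist A x y : R :=
  sup [set r | exists u v, [/\ A u, A v & r = (d x u + d y v - d x v - d y u) / 2]].

Lemma proj_dist_ub A x y u v : A u -> A v ->
  d x u + d y v - d x v - d y u <= 2 * proj_dist A x y.
Proof.
move=> Au Av.
suff: (d x u + d y v - d x v - d y u) / 2 <= proj_dist A x y by lra.
apply: ub_le_sup; last by exists u, v.
exists (d x y) => _ [u' [v' [_ _ ->]]].
have := metric_triangle x y u'; have := metric_triangle y x v'.
by have := metric_sym x y; lra.
Qed.

Lemma proj_dist_le A x y (k : R) : A !=set0 ->
  (forall u v, A u -> A v -> d x u + d y v - d x v - d y u <= 2 * k) ->
  proj_dist A x y <= k.
Proof.
move=> [a Aa] h; apply: ge_sup; first by exists ((d x a + d y a - d x a - d y a) / 2), a, a.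
by move=> _ [u [v [Au Av ->]]]; have := h _ _ Au Av; lra.
Qed.

Lemma proj_dist_le_mdist A x y : A !=set0 -> proj_dist A x y <= d x y.
Proof.
move=> A0; apply: proj_dist_le => // u v _ _.
have := metric_triangle x y u; have := metric_triangle y x v.
by have := metric_sym x y; lra.
Qed.

Lemma proj_dist_sym A x y : proj_dist A x y = proj_dist A y x.
Proof.
congr sup; apply/seteqP; split=> r [u [v [Au Av ->]]]; exists v, u; split=> //; lra.
Qed.

Lemma proj_distxx A x : A !=set0 -> proj_dist A x x = 0.
Proof.
move=> A0; apply/eqP; rewrite eq_le; apply/andP; split.
  by apply: proj_dist_le => // u v _ _; lra.
by case: A0 => a Aa; have := proj_dist_ub x x Aa Aa; lra.
Qed.

Lemma proj_dist_triangle A x y z : A !=set0 ->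
  proj_dist A x z <= proj_dist A x y + proj_dist A y z.
Proof.
move=> A0; apply: proj_dist_le => // u v Au Av.
by have := proj_dist_ub x y Au Av; have := proj_dist_ub y z Au Av; lra.
Qed.

Section Gates.
Variables (A : set X) (c : R).

Lemma gated_nonempty x : gated c A -> A !=set0.
Proof. by move=> /(_ x)[x' [? _]]; exists x'. Qed.

(** This estimate and the next one: up to c, [proj_dist] is the distance between
    gates. *)
Lemma proj_dist_gate_ge x y x' y' : gate A c x x' -> gate A c y y' ->
  d x' y' - c <= proj_dist A x y.
Proof.
move=> [Ax gx] [Ay gy]; have := proj_dist_ub x y Ay Ax.
by have := gx _ Ay; have := gy _ Ax; have := metric_sym x' y'; lra.
Qed.

Lemma proj_dist_gate_le x y x' y' : gate A c x x' -> gate A c y y' ->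
  proj_dist A x y <= d x' y' + c.
Proof.
move=> [Ax gx] [Ay gy]; apply: proj_dist_le; first by exists x'.
move=> u v Au Av.
have := metric_triangle x x' u; have := metric_triangle y y' v.
have := gx _ Av; have := gy _ Au.
have := metric_triangle x' y' u; have := metric_triangle y' x' v.
by have := metric_sym x' y'; lra.
Qed.

(** If the projections to A are far apart, the first alternative of the four-point
    inequality is excluded, so a path from x to y enters A near x', follows A and
    leaves it near y'. *)
Lemma proj_dist_through (delta : R) x y x' y' : four_point delta -> delta <= c ->
  gate A c x x' -> gate A c y y' -> 3 * c < proj_dist A x y ->
  d x x' + d x' y' + d y' y - 4 * c <= d x y.
Proof.
move=> hyp dc gx gy D; have := proj_dist_gate_le gx gy.
case: gx gy => [Ax gx] [Ay gy].
have := gx _ Ay; have := gy _ Ax; have := metric_sym x' y'.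
have := metric_sym y y'; have := metric_sym x x'.
by have := hyp x y y' x'; rewrite (metric_sym y' x') => -[]; lra.
Qed.

Lemma gate_detour x x' u v : gate A c x x' -> A u -> A v ->
  2 * d x x' <= detour u x v + 2 * c.
Proof.
move=> [_ gx] Au Av; rewrite /detour.
have := gx _ Au; have := gx _ Av; have := metric_triangle u x' v.
by have := metric_sym u x; have := metric_sym u x'; lra.
Qed.

Lemma proj_dist_detour (delta : R) x y x' : four_point delta -> delta <= c ->
  gated c A -> gate A c x x' -> 3 * c < proj_dist A x y ->
  detour x x' y <= 4 * c.
Proof.
move=> hyp dc gA gx D; have [y' gy] := gA y.
have := proj_dist_through hyp dc gx gy D; rewrite /detour.
by have := metric_triangle x' y' y; lra.
Qed.

(** An axis separating x from y is closer to x than y is, by the amount of the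
    separation; this is what makes induction on the distance possible. *)
Lemma proj_dist_closer (delta : R) x x' y : four_point delta -> delta <= c ->
  gated c A -> gate A c x x' -> 3 * c < proj_dist A x y ->
  d x x' + proj_dist A x y - 5 * c <= d x y.
Proof.
move=> hyp dc gA gx D; have [y' gy] := gA y.
have := proj_dist_through hyp dc gx gy D.
have := proj_dist_gate_le gx gy.
by have := mdist_ge0 y' y; lra.
Qed.

End Gates.

(** By [proj_dist_closer], if Y separates x from Z then x is closer to Y than to Z,
    and vice versa; both cannot happen. *)
Lemma behrstock (delta c : R) (Y Z : set X) x y z : four_point delta -> delta <= c ->
  gated c Y -> gated c Z ->
  (forall z1 z2, Z z1 -> Z z2 -> proj_dist Y z1 z2 <= c) ->
  (forall y1 y2, Y y1 -> Y y2 -> proj_dist Z y1 y2 <= c) ->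
  Z z -> Y y -> 6 * c < proj_dist Y x z -> proj_dist Z x y <= 6 * c.
Proof.
move=> hyp dc gY gZ YZ ZY Zz Yy D; rewrite leNgt; apply/negP => D'.
have [x1 gx1] := gY x; have [x2 gx2] := gZ x.
have Y0 : Y !=set0 by exists y. have Z0 : Z !=set0 by exists z.
have c0 : 0 <= c by have := YZ _ _ Zz Zz; rewrite proj_distxx.
have E1 : 5 * c < proj_dist Y x x2.
  have := proj_dist_triangle x x2 z Y0; have := YZ _ _ (gx2.1) Zz; lra.
have E2 : 5 * c < proj_dist Z x x1.
  have := proj_dist_triangle x x1 y Z0; have := ZY _ _ (gx1.1) Yy; lra.
have := proj_dist_closer hyp dc gY gx1 (y := x2).
by have := proj_dist_closer hyp dc gZ gx2 (y := x1); lra.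
Qed.

End HyperbolicGeometry.

(** * Isometric actions *)

Section IsometricActions.
Variables (R : realType) (X : metricType R) (G : groupType).
Variable rho : isometric_action G X.
Implicit Types (x y : X) (A : set X) (g h : G).
Local Notation d := (@mdist R X).

Lemma actVK g x : rho g^-1%g (rho g x) = x.
Proof. by rewrite -actM mulVg act1. Qed.

Lemma actKV g x : rho g (rho g^-1%g x) = x.
Proof. by rewrite -actM mulgV act1. Qed.

Lemma act_image1 A : rho 1%g @` A = A.
Proof.
by apply/seteqP; split=> [_ [x Ax <-]|x Ax]; rewrite ?act1 //; exists x; rewrite ?act1.
Qed.

Lemma act_imageM g h A : rho (g * h)%g @` A = rho g @` (rho h @` A).
Proof.
apply/seteqP; split=> [_ [x Ax <-]|_ [_ [x Ax <-] <-]].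
  by exists (rho h x); [exists x | rewrite actM].
by exists x; rewrite ?actM.
Qed.

Lemma act_imageV g A : rho g^-1%g @` (rho g @` A) = A.
Proof. by rewrite -act_imageM mulVg act_image1. Qed.

Lemma detour_act g x y z : detour (rho g x) (rho g y) (rho g z) = detour x y z.
Proof. by rewrite /detour !isom_actP. Qed.

Lemma proj_dist_act g A x y :
  proj_dist (rho g @` A) (rho g x) (rho g y) = proj_dist A x y.
Proof.
congr sup; apply/seteqP; split=> r.
  move=> [_ [_ [[u Au <-] [v Av <-] ->]]]; exists u, v; split=> //.
  by rewrite !isom_actP.
move=> [u [v [Au Av ->]]]; exists (rho g u), (rho g v); split; try by exists u + exists v.
by rewrite !isom_actP.
Qed.

Lemma gate_act (c : R) g A x x' : gate A c x x' ->
  gate (rho g @` A) c (rho g x) (rho g x').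
Proof.
move=> [Ax gx]; split; first by exists x'.
by move=> _ [u Au <-]; rewrite !isom_actP; exact: gx.
Qed.

Lemma gated_act (c : R) g A : gated c A -> gated c (rho g @` A).
Proof.
move=> gA x; have [x' gx] := gA (rho g^-1%g x); exists (rho g x').
by have := gate_act g gx; rewrite actKV.
Qed.

(** The image of a gate under an isometry preserving A is a gate of the image. *)
Lemma proj_dist_translation (c : R) g A x x' : rho g @` A = A -> gate A c x x' ->
  d x' (rho g x') - c <= proj_dist A x (rho g x).
Proof.
move=> gA gx; apply: proj_dist_gate_ge => //.
by rewrite -[A in gate A]gA; exact: gate_act.
Qed.

End IsometricActions.

Section Generated.
Variable G : groupType.
Local Open Scope group_scope.

Lemma unconj (h k : G) : k * (k^-1 * h * k) * k^-1 = h.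
Proof. by rewrite !mulgA mulgV mul1g mulgK. Qed.

(** Products of elements of S; a subgroup when S is closed under inversion, which
    is the case for every S used below. *)
Inductive generated (S : set G) : set G :=
| generated1 : generated S 1
| generatedM s g : S s -> generated S g -> generated S (s * g).

Variable S : set G.

Lemma generated_mul g h : generated S g -> generated S h -> generated S (g * h).
Proof.
move=> Sg Sh; elim: Sg => [|s k Ss _ IH]; first by rewrite mul1g.
by rewrite -mulgA; apply: generatedM.
Qed.

Lemma sub_generated s : S s -> generated S s.
Proof. by move=> Ss; rewrite -[s]mulg1; apply: generatedM => //; exact: generated1. Qed.

Lemma generated_inv g : (forall s, S s -> S s^-1) -> generated S g ->
  generated S g^-1.
Proof.
move=> SV; elim=> [|s h Ss _ IH]; first by rewrite invg1; exact: generated1.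
by rewrite invgM; apply: generated_mul => //; apply: sub_generated; exact: SV.
Qed.

Lemma generated_conj g h : (forall s k, S s -> S (k * s * k^-1)) -> generated S g ->
  generated S (h * g * h^-1).
Proof.
move=> SJ; elim=> [|s k Ss _ IH]; first by rewrite mulg1 mulgV; exact: generated1.
have -> : h * (s * k) * h^-1 = (h * s * h^-1) * (h * k * h^-1).
  by rewrite !mulgA mulgVK.
by apply: generatedM => //; exact: SJ.
Qed.

Lemma generated_mono (S' : set G) g : S `<=` S' -> generated S g -> generated S' g.
Proof.
by move=> SS'; elim=> [|s h Ss _]; [exact: generated1|apply: generatedM; exact: SS'].
Qed.

End Generated.

(** * Spinning families *)

Section Spinning.
Variables (R : realType) (X : metricType R) (G : groupType).
Variable rho : isometric_action G X.
Local Notation d := (@mdist R X).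

(** A family of coarsely convex axes with pairwise bounded projections, each with
    a group of rotations that acts coarsely transitively at the scale Lam and
    without nontrivial elements shorter than Lam, both up to c. *)
Record spinning_family (c Lam : R) (fam : set (set X)) (rot : set X -> set G) : Prop :=
  SpinningFamily {
    spin_gated : forall A, fam A -> gated c A;
    spin_act : forall g A, fam A -> fam (rho g @` A);
    spin_far : forall A B x y, fam A -> fam B -> A <> B -> B x -> B y ->
      proj_dist A x y <= c;
    spin_subgroup : forall A, fam A -> subgroup (rot A);
    spin_conj : forall g h A, fam A -> rot A h ->
      rot (rho g @` A) (g * h * g^-1)%g;
    spin_fix : forall A h, fam A -> rot A h -> rho h @` A = A;
    spin_large : forall A h x, fam A -> rot A h -> h <> 1%g ->
      Lam - c <= proj_dist A x (rho h x);
    spin_dense : forall A x y, fam A -> A x -> A y ->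
      exists2 h, rot A h & d x (rho h y) <= Lam + c }.

(** The product gap 0 * turn 0 * gap 1 * ... * turn (m - 1) * gap m, where turn j
    is a rotation about axis j and mark j is a point of that axis close to the
    base point.  Functions on all of nat spare the bookkeeping of lengths; only
    the indices up to m count. *)
Record word := Word {
  gap : nat -> G; turn : nat -> G; axis : nat -> set X; mark : nat -> X }.

Definition wcons (u r : G) (A : set X) (y : X) (W : word) : word := Word
  (fun j => if j is k.+1 then gap W k else u)
  (fun j => if j is k.+1 then turn W k else r)
  (fun j => if j is k.+1 then axis W k else A)
  (fun j => if j is k.+1 then mark W k else y).

Definition wset (u r : G) (W : word) : word := Word
  (fun j => if j is k.+1 then gap W k.+1 else u)
  (fun j => if j is k.+1 then turn W k.+1 else r) (axis W) (mark W).

Definition wtail (W : word) : word := Word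
  (fun j => gap W j.+1) (fun j => turn W j.+1) (fun j => axis W j.+1)
  (fun j => mark W j.+1).

Fixpoint prefix_prod (W : word) (j : nat) : G :=
  if j is k.+1 then (prefix_prod W k * gap W k * turn W k)%g else 1%g.

Definition wprod (W : word) (m : nat) : G := (prefix_prod W m * gap W m)%g.

Lemma prefix_prodS W j :
  prefix_prod W j.+1 = (gap W 0 * turn W 0 * prefix_prod (wtail W) j)%g.
Proof.
elim: j => [|j IH]; first by rewrite /= mul1g mulg1.
by rewrite -[LHS]/(prefix_prod W j.+1 * gap W j.+1 * turn W j.+1)%g IH /= !mulgA.
Qed.

Lemma wprodS W m : wprod W m.+1 = (gap W 0 * turn W 0 * wprod (wtail W) m)%g.
Proof. by rewrite /wprod prefix_prodS !mulgA. Qed.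

Variables (c Lam : R) (fam : set (set X)) (rot : set X -> set G).
Hypothesis spin : spinning_family c Lam fam rot.
Hypothesis c0 : 0 < c.
Hypothesis hyp : four_point X c.
Variable p : X.

Lemma fam_nonempty A : fam A -> A !=set0.
Proof. move=> fA; exact: (gated_nonempty p (spin_gated spin fA)). Qed.

Section Level.
Variables (N : set G) (t T : R).
Hypothesis Nsub : subgroup N.

Let N1 : N 1%g. Proof. by case: Nsub. Qed.
Let NM g h : N g -> N h -> N (g * h)%g. Proof. by case: Nsub => _ + _; apply. Qed.
Let NV g : N g -> N g^-1%g. Proof. by case: Nsub => _ _; apply. Qed.

(** The distance from A to the orbit N p is at least s.  With s = t this says that
    A is new for N. *)
Definition far_from (s : R) (A : set X) : Prop :=
  forall g x, N g -> A x -> s <= d (rho g p) x.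

Definition letter (r : G) (A : set X) (y : X) : Prop :=
  [/\ fam A, rot A r, r <> 1%g, far_from t A & A y /\ d p y < t + T].

(** The last condition says that consecutive pivots, carried to a common place, are
    distinct, so that two turns never act about the same axis in succession. *)
Definition reduced (W : word) (m : nat) : Prop :=
  [/\ forall j, (j <= m)%N -> N (gap W j),
      forall j, (j < m)%N -> letter (turn W j) (axis W j) (mark W j)
    & forall j, (j.+1 < m)%N ->
        rho (gap W j.+1) @` axis W j.+1 <> axis W j].

Lemma far_from_act s A g : N g -> far_from s A -> far_from s (rho g @` A).
Proof.
move=> Ng fA h _ Nh [x Ax <-]; have := fA (g^-1 * h)%g x (NM (NV Ng) Nh) Ax.
by rewrite actM -[d (rho h p) _](isom_actP rho g^-1%g) actVK.
Qed.

(** For N = level i these elements generate level i + 1 ([level_succ]).  Restricting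
    to new axes is what bounds the view that a pivot has of the orbit N p. *)
Definition level_gen : set G := [set h | N h \/
  exists A y, [/\ fam A, rot A h, far_from t A & A y /\ d p y < t + T]].

(** Multiplying a reduced word on the left by a rotation only affects its
    beginning: a new pivot is added unless it coincides with the first one, in
    which case the two turns are merged, and if they cancel the two gaps are. *)
Lemma reducedP g : generated level_gen g ->
  exists W m, reduced W m /\ wprod W m = g.
Proof.
elim=> [|s h Ss _ [W [m [redW <-]]]].
  exists (Word (fun=> 1%g) (fun=> 1%g) (fun=> set0) (fun=> p)), 0%N.
  by split; [split | rewrite /wprod /= mulg1].
have NU k : N k -> exists W' m', reduced W' m' /\ wprod W' m' = (k * wprod W m)%g.
  move=> Nk; exists (wset (k * gap W 0)%g (turn W 0) W), m.
  case: redW => h1 h2 h3; split; first split.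
  - by move=> [|j] jm /=; [apply: NM => //|]; exact: h1.
  - by move=> [|j] jm /=; exact: h2.
  - by move=> j jm /=; exact: h3.
  - by case: m {h1 h2 h3} => [|m]; rewrite /wprod ?prefix_prodS /= ?mul1g // !mulgA.
case: Ss => [Ns|[A [y [fA rs fr Ay]]]]; first exact: NU.
have [->|/eqP s1] := eqVneq s 1%g; first by apply: NU.
have cons : (forall m', m = m'.+1 -> rho (gap W 0) @` axis W 0 <> A) ->
    exists W' m', reduced W' m' /\ wprod W' m' = (s * wprod W m)%g.
  move=> nA; exists (wcons 1%g s A y W), m.+1; split.
    case: redW => h1 h2 h3; split.
    - by move=> [|j] jm //=; exact: h1.
    - by move=> [|j] jm /=; [split|exact: h2].
    - by move=> [|j] jm /=; [exact: (nA _ (esym (prednK jm))) | exact: h3].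
  by rewrite wprodS /= mul1g; congr (_ * _)%g; case: (W).
case: m => [|m] in redW cons NU *; first exact: cons.
have [eA|nA] := pselect (rho (gap W 0) @` axis W 0 = A); last first.
  by apply: cons.
have [h1 h2 h3] := redW.
have [fY rY Y1 frY nY] := h2 0%N isT.
pose r := ((gap W 0)^-1 * s * gap W 0 * turn W 0)%g.
have rr : rot (axis W 0) r.
  case: (spin_subgroup spin fY) => _ rM _; apply: rM => //.
  by have := spin_conj spin (gap W 0)^-1%g fA rs; rewrite invgK -eA act_imageV.
have er : (s * wprod W m.+1)%g = (gap W 0 * r * wprod (wtail W) m)%g.
  by rewrite wprodS /r !mulgA mulgV mul1g.
have [r1|/eqP r1] := eqVneq r 1%g.
  exists (wset (gap W 0 * gap W 1)%g (turn W 1) (wtail W)), m; split.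
    split.
    - by move=> [|j] jm /=; [apply: NM; exact: h1|exact: h1].
    - by move=> [|j] jm /=; exact: h2.
    - by move=> j jm /=; exact: h3.
  rewrite er r1 mulg1; case: m {h1 h2 h3 redW cons NU er} => [|m].
    by rewrite /wprod /= !mul1g.
  by rewrite wprodS [in RHS]wprodS /= !mulgA; congr (_ * _)%g; rewrite /wprod.
exists (wset (gap W 0) r W), m.+1; split.
  split.
  - by move=> [|j] jm /=; exact: h1.
  - by move=> [|j] jm /=; [split|exact: h2].
  - by move=> j jm /=; exact: h3.
by rewrite er wprodS.
Qed.

(** An axis far from x0 cannot separate x0 from a point y near x0. *)
Lemma proj_dist_near s k A x0 y : fam A -> (forall x, A x -> s <= d x0 x) ->
  3 * c <= k -> d x0 y - s + 5 * c <= k -> proj_dist A x0 y <= k.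
Proof.
move=> fA sA ck yk; rewrite leNgt; apply/negP => kD.
have gA := spin_gated spin fA; have [p' gp] := gA x0.
have := proj_dist_closer hyp (lexx c) gA gp (y := y).
by have := sA _ (gp.1); lra.
Qed.

Lemma far_from1 s A x : far_from s A -> A x -> s <= d p x.
Proof. by move=> /(_ 1%g x N1); rewrite act1. Qed.

(** The path of a reduced word: from p, each gap leads from the departure point
    behind one pivot to the arrival point before the next one, and each turn
    rotates the arrival point about the pivot to the next departure point.  The
    marks are points of the pivots near arrival and departure. *)
Section Chain.
Variables (D1 : R) (W : word) (m : nat).
Hypothesis gapD : forall u A, N u -> fam A -> far_from t A ->
  proj_dist A p (rho u p) <= D1.
Hypothesis T0 : 0 <= T.
Hypothesis Lam_big : 12 * c < Lam - c - 2 * D1 - 2 * (T + 11 * c).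
Hypothesis redW : reduced W m.

Local Ltac chain_lra := have := c0; have := T0; have := Lam_big; lra.

Definition chain_axis j : set X := rho (prefix_prod W j * gap W j)%g @` axis W j.
Definition arrival j : X := rho (prefix_prod W j * gap W j)%g p.
Definition departure j : X := rho (prefix_prod W j) p.
Definition arrival_mark j : X := rho (prefix_prod W j * gap W j)%g (mark W j).
Definition departure_mark j : X := rho (prefix_prod W j.+1) (mark W j).

Local Notation Z := chain_axis.
Local Notation b := arrival.
Local Notation e := departure.
Local Notation zb := arrival_mark.
Local Notation ze := departure_mark.

Lemma letter_at j : (j < m)%N -> letter (turn W j) (axis W j) (mark W j).
Proof. by case: redW => _ h _; exact: h. Qed.

Lemma gap_at j : (j <= m)%N -> N (gap W j).
Proof. by case: redW => h _ _; exact: h. Qed.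

Lemma chain_fam j : (j < m)%N -> fam (Z j).
Proof. by move=> /letter_at[? _ _ _ _]; exact: (spin_act spin). Qed.

Lemma chain_nonempty j : (j < m)%N -> Z j !=set0.
Proof. by move=> jm; apply: fam_nonempty; exact: chain_fam. Qed.

Lemma chain_axis_departure j : (j < m)%N ->
  Z j = rho (prefix_prod W j.+1) @` axis W j.
Proof.
by move=> /letter_at[fY rY _ _ _]; rewrite /= act_imageM (spin_fix spin fY rY).
Qed.

Lemma arrival_mark_in j : (j < m)%N -> Z j (zb j).
Proof. by move=> /letter_at[_ _ _ _ [? _]]; exists (mark W j). Qed.

Lemma departure_mark_in j : (j < m)%N -> Z j (ze j).
Proof.
move=> jm; rewrite chain_axis_departure //.
by case/letter_at: jm => _ _ _ _ [? _]; exists (mark W j).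
Qed.

Lemma turn_large j : (j < m)%N -> Lam - c <= proj_dist (Z j) (b j) (e j.+1).
Proof.
move=> /letter_at[fY rY Y1 _ _].
by rewrite /Z /e /= (actM rho _ (turn W j)) proj_dist_act; exact: (spin_large spin).
Qed.

Lemma gap_before j : (j < m)%N -> proj_dist (Z j) (e j) (b j) <= D1.
Proof.
move=> jm; have [fY _ _ farY _] := letter_at jm; have Nu := gap_at (ltnW jm).
rewrite /Z act_imageM /b actM proj_dist_act; apply: gapD => //.
  exact: (spin_act spin).
exact: far_from_act.
Qed.

Lemma gap_after j : (j < m)%N -> proj_dist (Z j) (e j.+1) (b j.+1) <= D1.
Proof.
move=> jm; have [fY _ _ farY _] := letter_at jm.
by rewrite chain_axis_departure // /b actM proj_dist_act; apply: gapD => //; exact: gap_at.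
Qed.

(** The pivot before Z (j + 1) is near the departure point, whereas Z (j + 1) is new
    and hence far from it; [next_axis] is the same in the other direction. *)
Lemma previous_axis j : (j.+1 < m)%N ->
  proj_dist (Z j.+1) (e j.+1) (ze j) <= T + 5 * c.
Proof.
move=> jm; have [fY _ _ farY _] := letter_at jm.
have [_ _ _ _ [_ yt]] := letter_at (ltnW jm).
rewrite /Z act_imageM proj_dist_act; have Nu := gap_at (ltnW jm).
apply: (@proj_dist_near t); first exact: (spin_act spin).
- by move=> x; apply: far_from1; exact: far_from_act.
- by chain_lra.
- by chain_lra.
Qed.

Lemma next_axis j : (j.+1 < m)%N ->
  proj_dist (Z j) (b j.+1) (zb j.+1) <= T + 5 * c.
Proof.
move=> jm; have [_ _ _ _ [_ yt]] := letter_at jm.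
have [fY _ _ farY _] := letter_at (ltnW jm); have Nu := gap_at (ltnW jm).
rewrite chain_axis_departure ?(ltnW jm) // -[axis W j](act_image1 rho).
rewrite -(mulgV (gap W j.+1)) [in X in proj_dist X]act_imageM -act_imageM.
rewrite proj_dist_act; apply: (@proj_dist_near t); first exact: (spin_act spin).
- by move=> x; apply: far_from1; apply: far_from_act => //; exact: NV.
- by chain_lra.
- by chain_lra.
Qed.

Lemma chain_far j : (j.+1 < m)%N -> Z j <> Z j.+1.
Proof.
move=> jm; rewrite chain_axis_departure ?(ltnW jm) // /Z act_imageM => eZ.
case: redW => _ _ /(_ _ jm); apply.
by rewrite -[LHS](act_imageV rho (prefix_prod W j.+1)) -eZ act_imageV.
Qed.

Lemma axes_behrstock A B x z y : fam A -> fam B -> A <> B -> B z -> A y ->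
  6 * c < proj_dist A x z -> proj_dist B x y <= 6 * c.
Proof.
move=> fA fB AB Bz Ay; apply: (behrstock hyp (lexx c)) => //; try exact: (spin_gated spin).
  by move=> *; apply: (spin_far spin fA fB).
by move=> *; apply: (spin_far spin fB fA) => // /esym.
Qed.

(** Induction along the chain.  Seen from Z j, the long turn separates p from the
    next pivot Z (j + 1); Behrstock's inequality turns this into the statement that
    Z (j + 1) does not separate p from Z j. *)
Lemma chain_forward j : (j < m)%N -> proj_dist (Z j) p (e j) <= T + 11 * c.
Proof.
elim: j => [|j IH] jm.
  rewrite /e /= act1 proj_distxx; first chain_lra; exact: chain_nonempty.
have jm' := ltnW jm; have Z0 := chain_nonempty jm'; have Z1 := chain_nonempty jm.
have t1 := proj_dist_triangle p (e j) (zb j.+1) Z0.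
have t2 := proj_dist_triangle (b j) (e j) (e j.+1) Z0.
have t3 := proj_dist_triangle (b j) (e j) p Z0.
have t4 := proj_dist_triangle (e j.+1) (b j.+1) (zb j.+1) Z0.
have t5 := proj_dist_triangle (b j) p (e j.+1) Z0.
have t6 := proj_dist_triangle p (zb j.+1) (e j.+1) Z0.
have s1 := proj_dist_sym (Z j) (b j) (e j).
have s2 := proj_dist_sym (Z j) (e j) p.
have s3 := proj_dist_sym (Z j) (e j.+1) (zb j.+1).
have big : 6 * c < proj_dist (Z j) p (zb j.+1).
  have := IH jm'; have := turn_large jm'; have := gap_before jm'.
  by have := gap_after jm'; have := next_axis jm; chain_lra.
have := axes_behrstock (chain_fam jm') (chain_fam jm) (chain_far jm)
  (arrival_mark_in jm) (departure_mark_in jm') big.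
have := proj_dist_triangle p (ze j) (e j.+1) Z1.
by have := previous_axis jm; have := proj_dist_sym (Z j.+1) (e j.+1) (ze j); chain_lra.
Qed.

Lemma chain_backward j : (j < m)%N -> proj_dist (Z j) (b j.+1) (b m) <= T + 11 * c.
Proof.
move=> jm; have [k ek] : exists k, m = (j + k.+1)%N by exists (m - j.+1)%N; lia.
elim: k j => [|k IH] j in jm ek *.
  by rewrite ek addn1 proj_distxx; [chain_lra | exact: chain_nonempty].
have jm1 : (j.+1 < m)%N by lia.
have IHj := IH j.+1 jm1 ltac:(lia).
have Z0 := chain_nonempty jm; have Z1 := chain_nonempty jm1.
have t1 := proj_dist_triangle (b j.+1) (e j.+1) (e j.+2) Z1.
have t2 := proj_dist_triangle (e j.+1) (ze j) (b m) Z1.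
have t3 := proj_dist_triangle (e j.+1) (b m) (e j.+2) Z1.
have t4 := proj_dist_triangle (b m) (b j.+2) (e j.+2) Z1.
have s1 := proj_dist_sym (Z j.+1) (b j.+1) (e j.+1).
have s2 := proj_dist_sym (Z j.+1) (b m) (b j.+2).
have s3 := proj_dist_sym (Z j.+1) (b j.+2) (e j.+2).
have s4 := proj_dist_sym (Z j.+1) (ze j) (b m).
have big : 6 * c < proj_dist (Z j.+1) (b m) (ze j).
  have := turn_large jm1; have := gap_before jm1; have := gap_after jm1.
  by have := previous_axis jm1; chain_lra.
have := axes_behrstock (chain_fam jm1) (chain_fam jm) (not_eq_sym (chain_far jm1))
  (departure_mark_in jm) (arrival_mark_in jm1) big.
have := proj_dist_triangle (b j.+1) (zb j.+1) (b m) Z0.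
by have := next_axis jm1; have := proj_dist_sym (Z j) (b m) (zb j.+1); chain_lra.
Qed.

(** The turn at each pivot is not undone by the rest of the word. *)
Lemma chain_large j : (j < m)%N ->
  Lam - c - 2 * D1 - 2 * (T + 11 * c) <= proj_dist (Z j) p (b m).
Proof.
move=> jm; have Z0 := chain_nonempty jm.
have := chain_forward jm; have := chain_backward jm; have := turn_large jm.
have := gap_before jm; have := gap_after jm.
have := proj_dist_triangle (b j) (e j) (e j.+1) Z0.
have := proj_dist_triangle (e j) p (e j.+1) Z0.
have := proj_dist_triangle p (b m) (e j.+1) Z0.
have := proj_dist_triangle (b m) (b j.+1) (e j.+1) Z0.
have := proj_dist_sym (Z j) (b j) (e j); have := proj_dist_sym (Z j) (e j) p.
have := proj_dist_sym (Z j) (b m) (b j.+1).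
by have := proj_dist_sym (Z j) (b j.+1) (e j.+1); chain_lra.
Qed.

Lemma arrival_markP j : (j < m)%N -> d (b j) (zb j) < t + T.
Proof. by move=> /letter_at[_ _ _ _ [_ yt]]; rewrite isom_actP. Qed.

Lemma departure_markP j : (j < m)%N -> d (e j.+1) (ze j) < t + T.
Proof. by move=> /letter_at[_ _ _ _ [_ yt]]; rewrite isom_actP. Qed.

(** If V separated a pivot both from p and from the end point, then this pivot would
    see p and the end point near V, hence near each other, against [chain_large].
    So V sits between two consecutive pivots and only sees the gap between them;
    the constant 23 collects the errors on the two sides. *)
Lemma chain_avoiding V F : fam V ->
  (forall j x, (j <= m)%N -> V x -> t + T <= d (e j) x) ->
  (forall j x, (j <= m)%N -> V x -> t + T <= d (b j) x) ->
  (forall j, (j <= m)%N -> proj_dist V (e j) (b j) <= F) ->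
  proj_dist V p (b m) <= F + 23 * c.
Proof.
move=> fV Ve Vb VF; have V0 := fam_nonempty fV.
have VZ j : (j < m)%N -> V <> Z j.
  move=> jm eV; have := arrival_mark_in jm; rewrite -eV => /(Vb _ _ (ltnW jm)).
  by rewrite leNgt arrival_markP.
have ex : exists j, (j == m) || (6 * c < proj_dist V p (zb j)) by exists m; rewrite eqxx.
(* The first pivot that V separates from p, or m if there is none. *)
case: (ex_minnP ex) => j jP jmin.
have jm : (j <= m)%N by apply: jmin; rewrite eqxx.
have left_part : proj_dist V p (e j) <= 12 * c.
  case: j jm jmin {jP} => [|k] km kmin.
    by rewrite /e /= act1 proj_distxx //; chain_lra.
  have [v Vv] := V0.
  have small : proj_dist V p (zb k) <= 6 * c.
    rewrite leNgt; apply/negP => h; have := kmin k.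
    by rewrite h orbT ltnn => /(_ isT).
  have := spin_far spin fV (chain_fam km) (VZ k km) (arrival_mark_in km)
    (departure_mark_in km).
  have near_e : proj_dist V (e k.+1) (ze k) <= 5 * c.
    apply: (@proj_dist_near (t + T)) => //; first by move=> x; exact: Ve.
      chain_lra.
    by have := departure_markP km; chain_lra.
  have := proj_dist_triangle p (zb k) (e k.+1) V0.
  have := proj_dist_triangle (zb k) (ze k) (e k.+1) V0.
  by have := proj_dist_sym V (e k.+1) (ze k); chain_lra.
have right_part : proj_dist V (b j) (b m) <= 11 * c.
  case/orP: jP => [/eqP ->|big]; first by rewrite proj_distxx //; chain_lra.
  have [->|jm'] := eqVneq j m; first by rewrite proj_distxx //; chain_lra.
  have jltm : (j < m)%N by rewrite ltn_neqAle jm'.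
  have near_b : proj_dist V (b j) (zb j) <= 5 * c.
    apply: (@proj_dist_near (t + T)) => //; first by move=> x; exact: Vb.
      chain_lra.
    by have := arrival_markP jltm; chain_lra.
  have [v Vv] := V0.
  have pv := axes_behrstock fV (chain_fam jltm) (VZ _ jltm) (arrival_mark_in jltm) Vv big.
  have small : proj_dist V (b m) (zb j) <= 6 * c.
    rewrite leNgt; apply/negP => big'.
    have mv := axes_behrstock fV (chain_fam jltm) (VZ _ jltm) (arrival_mark_in jltm) Vv big'.
    have := chain_large jltm; have := proj_dist_sym (Z j) (b m) v.
    by have := proj_dist_triangle p v (b m) (chain_nonempty jltm); chain_lra.
  have := proj_dist_triangle (b j) (zb j) (b m) V0.
  by have := proj_dist_sym V (b m) (zb j); chain_lra.
have := proj_dist_triangle p (e j) (b m) V0.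
have := proj_dist_triangle (e j) (b j) (b m) V0.
by have := VF j jm; chain_lra.
Qed.

(** A point z near an axis is near a rotated copy of any point x near that axis,
    since the rotations are coarsely transitive at the scale Lam. *)
Lemma axis_dense A w w' y x z r : fam A -> A w -> A w' -> A y ->
  d x y < t + T -> detour w z w' <= r ->
  exists2 h, rot A h & d z (rho h x) <= r / 2 + Lam + 2 * c + t + T.
Proof.
move=> fA Aw Aw' Ay xy wz; have [z' gz] := spin_gated spin fA z.
have zz' := gate_detour gz Aw Aw'.
have [h rh dh] := spin_dense spin fA gz.1 Ay; exists h => //.
have := metric_triangle z z' (rho h x).
have := metric_triangle z' (rho h y) (rho h x).
by rewrite isom_actP (metric_sym y x); chain_lra.
Qed.

Lemma axis_side A w y x z r : fam A -> A w -> A y ->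
  d x y < t + T -> detour w z x <= r ->
  exists2 h, rot A h & d z (rho h x) <= r / 2 + Lam + 3 * c + t + T.
Proof.
move=> fA Aw Ay xy wz; case: (detour_insert hyp w y x z) => wz'.
  have wz2 : detour w z y <= r + 2 * c by chain_lra.
  have [h rh dh] := axis_dense fA Aw Ay Ay xy wz2; exists h => //; chain_lra.
exists 1%g; first by case: (spin_subgroup spin fA).
rewrite act1; move: wz wz'; rewrite /detour.
have [h rh dh] := spin_dense spin fA Ay Ay.
have := mdist_ge0 y (rho h y).
have := metric_triangle z y x; have := metric_sym y z; have := metric_sym y x.
chain_lra.
Qed.

(** Coarse convexity of the path of a reduced word: a point z near the direct path
    from p to the end point is near one of the gaps or near a pivot, and in the
    latter case near a rotated copy of an end point of the turn.  The chain used
    consists of the gates of p and of the end point in the pivots; these lie near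
    the direct path because the pivots are crossed over a long distance. *)
Lemma chain_near z q : detour p z (b m) <= q ->
  (exists2 j, (j <= m)%N & detour (e j) z (b j) <= q + 14 * c) \/
  (exists j h, [/\ (j < m)%N, rot (Z j) h &
     d z (rho h (b j)) <= q / 2 + Lam + 10 * c + t + T \/
     d z (rho h (e j.+1)) <= q / 2 + Lam + 10 * c + t + T]).
Proof.
move=> zq.
have gates x : exists P : nat -> X, forall j, (j < m)%N -> gate (Z j) c x (P j).
  suff /choice[P hP] : forall j, exists y, (j < m)%N -> gate (Z j) c x y by exists P.
  move=> j; have [jm|_] := boolP (j < m)%N; last by exists x.
  by have [y gy] := spin_gated spin (chain_fam jm) x; exists y.
have [P hP] := gates p; have [Q hQ] := gates (b m).
(* p, P 0, Q 0, P 1, Q 1, ..., b m *)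
pose w l := if l is k.+1 then (if k == m.*2 then b m else if odd k then Q k./2 else P k./2) else p.
have wP j : (j < m)%N -> w j.*2.+1 = P j.
  by move=> jm; rewrite /w odd_double doubleK; case: eqP => // /double_inj ej; lia.
have wQ j : (j < m)%N -> w j.*2.+2 = Q j.
  move=> jm; rewrite /w /= odd_double /= uphalf_double; case: eqP => // ej; lia.
have wm : w m.*2.+1 = b m by rewrite /w eqxx.
have wend j : (j <= m)%N -> w j.*2.+1 = b j /\ j = m \/ (j < m)%N /\ Z j (w j.*2.+1).
  rewrite leq_eqVlt => /orP[/eqP ->|jm]; first by left.
  by right; split=> //; rewrite wP //; case: (hP j jm).
have wstart j : (j <= m)%N -> w j.*2 = e j /\ j = 0%N \/
    exists k, [/\ j = k.+1, (k < m)%N & Z k (w j.*2)].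
  case: j => [|j] jm; first by left; rewrite /e /= act1.
  by right; exists j; split=> //; rewrite doubleS wQ //; case: (hQ j jm).
have big j : (j < m)%N -> 3 * c < proj_dist (Z j) p (b m).
  by move=> jm; have := chain_large jm; chain_lra.
have we l : (l <= m.*2.+1)%N -> detour (w 0%N) (w l) (w m.*2.+1) <= 4 * c.
  rewrite wm /=; have end0 x y : detour x x y <= 4 * c.
    by rewrite /detour mdistxx; chain_lra.
  case: l => [|l] lm; first exact: end0.
  rewrite -(odd_double_half l); have lm' : (l./2 <= m)%N by lia.
  case: (boolP (odd l)) => ol; rewrite ?add0n ?add1n.
    have lm2 : (l./2 < m)%N by lia.
    rewrite wQ // detour_sym; apply: (proj_dist_detour hyp (lexx c)) => //.
    - exact: (spin_gated spin (chain_fam lm2)).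
    - exact: hQ.
    - by rewrite proj_dist_sym; exact: big.
  have [->|lm2] := eqVneq l./2 m.
    by rewrite wm detour_sym; exact: end0.
  have {}lm2 : (l./2 < m)%N by rewrite ltn_neqAle lm2.
  rewrite wP //; apply: (proj_dist_detour hyp (lexx c)) => //.
  - exact: (spin_gated spin (chain_fam lm2)).
  - exact: hP.
  - exact: big.
have wq : detour (w 0%N) z (w m.*2.+1) <= q by rewrite wm.
have e0 : 0 <= 4 * c by chain_lra.
have [l lm hl] := detour_chain hyp e0 (ltW c0) we isT wq.
have [j [jm ej]] : exists j, (j <= m)%N /\ (l = j.*2 \/ l = j.*2.+1 /\ (j < m)%N).
  by exists l./2; have := odd_double_half l; case: (odd l); split; lia.
(* A piece along the pivot Z j, or else one leading from a pivot to the next. *)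
case: ej => [|[]] el; last first.
  move=> jm'; move: hl; rewrite el wP // -doubleS doubleS wQ // => hl.
  have [h rh dh] := axis_dense (chain_fam jm') (hP j jm').1 (hQ j jm').1
    (arrival_mark_in jm') (arrival_markP jm') hl.
  by right; exists j, h; split=> //; left; chain_lra.
move: hl; rewrite el => hl.
case: (detour_insert hyp (w j.*2) (e j) (w j.*2.+1) z) => h1.
  have {}h1 : detour (w j.*2) z (e j) <= q + 12 * c by chain_lra.
  case: (wstart j jm) => [[ew _]|[k [ek km Zw]]].
    left; exists j => //; move: h1; rewrite ew /detour mdistxx.
    have := metric_sym z (e j); have := metric_triangle z (e j) (b j).
    chain_lra.
  rewrite ek in h1 Zw *.
  have [h rh dh] := axis_side (chain_fam km) Zw (departure_mark_in km)
    (departure_markP km) h1.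
  by right; exists k, h; split=> //; right; chain_lra.
case: (detour_insert hyp (e j) (b j) (w j.*2.+1) z) => h2.
  by left; exists j => //; chain_lra.
have {}h2 : detour (w j.*2.+1) z (b j) <= q + 14 * c.
  by rewrite detour_sym; chain_lra.
case: (wend j jm) => [[ew _]|[jm' Zw]].
  left; exists j => //; move: h2; rewrite ew /detour mdistxx.
  have := metric_sym z (b j); have := metric_sym (b j) (e j).
  have := metric_triangle z (b j) (e j).
  have := metric_sym z (e j); chain_lra.
have [h rh dh] := axis_side (chain_fam jm') Zw (arrival_mark_in jm')
  (arrival_markP jm') h2.
by right; exists j, h; split=> //; left; chain_lra.
Qed.

End Chain.
End Level.

(* The distance between levels: large enough to absorb the additive errors of each
   step, and small compared to Lam. *)
Local Notation T := (200 * c).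

Definition level_set (i : nat) : set G := [set h | exists A y,
  [/\ fam A, rot A h, A y & d p y < i%:R * T]].

Definition level (i : nat) : set G := generated (level_set i).

Lemma level_subgroup i : subgroup (level i).
Proof.
split; [exact: generated1 | by move=> *; exact: generated_mul |].
move=> g; apply: generated_inv => s [A [y [fA rs Ay py]]]; exists A, y; split=> //.
by case: (spin_subgroup spin fA) => _ _; apply.
Qed.

Lemma level0 g : level 0 g -> g = 1%g.
Proof.
elim=> // s h [A [y [_ _ _]]]; rewrite mul0r => py _ _.
by have := mdist_ge0 p y; rewrite leNgt py.
Qed.

Lemma level_mono i g : level i g -> level i.+1 g.
Proof.
apply: generated_mono => s [A [y [fA rs Ay py]]]; exists A, y; split=> //.
by have := c0; rewrite -natr1; lra.
Qed.

(** An axis that is not new for level i is a translate, by level i, of an axis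
    whose rotations already belong to level i. *)
Lemma level_succ i g : level i.+1 g ->
  generated (level_gen (level i) (i%:R * T) T) g.
Proof.
have [_ lM lV] := level_subgroup i.
apply: generated_mono => s [A [y [fA rs Ay py]]].
have [fr|nfr] := pselect (far_from (level i) (i%:R * T) A).
  right; exists A, y; split=> //; split=> //; move: py; rewrite -natr1; lra.
left; have [k [x [lk Ax kx]]] : exists k x, [/\ level i k, A x & d (rho k p) x < i%:R * T].
  apply/not_existsP => h; apply: nfr => k x lk Ax; rewrite leNgt; apply/negP => kx.
  by apply: (h k); exists x.
rewrite -(unconj s k).
apply: (lM _ _ _ (lV _ lk)); apply: (lM _ _ lk); apply: sub_generated.
exists (rho k^-1%g @` A), (rho k^-1%g x); split.
- exact: (spin_act spin).
- by have := spin_conj spin k^-1%g fA rs; rewrite invgK.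
- by exists x.
- by rewrite -(isom_actP rho k) actKV.
Qed.

Local Notation rho0 := (Lam + 10 * c).

(** The further A is from the orbit of level i, the smaller its view of it: the slope
    23 / 200 is the loss 23 c of [chain_avoiding] divided by the distance 200 c
    between levels. *)
Definition level_proj i : Prop := forall u s A, level i u -> fam A ->
  i%:R * T <= s -> s <= i%:R * T + rho0 + 2 * c -> far_from (level i) s A ->
  proj_dist A p (rho u p) <= 26 * c + 23 / 200 * (i%:R * T + rho0 + 2 * c - s).

(** The orbit of p under level i is coarsely convex; q / 2 bounds the Gromov
    product at z, which measures the distance from z to the path. *)
Definition level_convex i : Prop := forall u z q, level i u ->
  detour p z (rho u p) <= q ->
  exists2 v, level i v & d z (rho v p) <= q / 2 + i%:R * T + rho0.

(** Coarse convexity replaces the bound of [level_proj] by a universal one for axes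
    out of reach of the orbit, which stops the accumulation of losses. *)
Lemma level_proj_far i u s A : level_convex i -> level i u -> fam A ->
  i%:R * T + rho0 + 2 * c < s -> far_from (level i) s A ->
  proj_dist A p (rho u p) <= 3 * c.
Proof.
move=> conv lu fA si fr; rewrite leNgt; apply/negP => D.
have gA := spin_gated spin fA; have [p' gp] := gA p.
have [v lv zv] := conv u p' _ lu (proj_dist_detour hyp (lexx c) gA gp D).
by have := fr v p' lv gp.1; rewrite metric_sym; lra.
Qed.

Variable M : R.
Hypothesis M0 : 0 <= M.
Hypothesis Lam_big : 1000 * c + 2 * M <= Lam.

Local Notation D1 := (26 * c + 23 / 200 * (rho0 + 2 * c)).

Let consts : 0 < c /\ 0 <= M /\ 1000 * c + 2 * M <= Lam.
Proof. by []. Qed.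

Lemma level_gapD i u A : level_proj i -> level i u -> fam A ->
  far_from (level i) (i%:R * T) A -> proj_dist A p (rho u p) <= D1.
Proof.
move=> pr lu fA fr; have [? [? ?]] := consts.
by have := pr u _ A lu fA (lexx _) _ fr; move=> /(_ ltac:(lra)); lra.
Qed.

Lemma Lam_chain : 12 * c < Lam - c - 2 * D1 - 2 * (T + 11 * c).
Proof. by have [? [? ?]] := consts; lra. Qed.

Lemma T_ge0 : 0 <= T.
Proof. by have := c0; lra. Qed.

Lemma chain_in_level i W m : reduced (level i) (i%:R * T) T W m ->
  forall j, (j <= m)%N -> level i.+1 (prefix_prod W j) /\
    level i.+1 (prefix_prod W j * gap W j)%g.
Proof.
move=> [h1 h2 _]; have [l1 lM lV] := level_subgroup i.+1.
have lg j : (j <= m)%N -> level i.+1 (gap W j) by move=> /h1; exact: level_mono.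
elim=> [|j IH] jm; first by split=> //=; rewrite mul1g; exact: lg.
have lp : level i.+1 (prefix_prod W j.+1).
  rewrite /=; apply: (lM _ _ (IH (ltnW jm)).2); apply: sub_generated.
  have [fA rA _ _ [yA yT]] := h2 _ jm; exists (axis W j), (mark W j); split=> //.
  by rewrite -natr1; lra.
by split=> //; apply: lM => //; exact: lg.
Qed.

(** For A at distance s from the orbit, passing to the next level costs 23 c by
    [chain_avoiding], which the increase of i T by 200 c in the bound compensates
    exactly; if A was out of reach of level i one starts again from 3 c.
    Convexity loses at most 7 c, which is less than T, in a gap, and in a pivot it
    follows from the density of the rotations without using the previous level. *)
Lemma level_step i : level_proj i -> level_convex i ->
  level_proj i.+1 /\ level_convex i.+1.
Proof.
move=> pr conv; have [? [? ?]] := consts.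
have gD u A := @level_gapD i u A pr.
have eT : i.+1%:R * T = i%:R * T + T by rewrite -natr1; lra.
split.
  move=> u s A /level_succ/(reducedP (level_subgroup i))[W [m [redW <-]]] fA ls sl fr.
  have lv := chain_in_level redW.
  set F := 3 * c + 23 / 200 * (i.+1%:R * T + rho0 + 2 * c - s) .
  have -> : 26 * c + 23 / 200 * (i.+1%:R * T + rho0 + 2 * c - s) = F + 23 * c.
    by rewrite /F; lra.
  apply: (chain_avoiding (level_subgroup i) gD T_ge0 Lam_chain redW) => //.
  - by move=> j x jm Ax; have := fr _ x (lv j jm).1 Ax; rewrite /departure; lra.
  - by move=> j x jm Ax; have := fr _ x (lv j jm).2 Ax; rewrite /arrival; lra.
  move=> j jm; have lvj := (lv j jm).1; have [_ lM lV] := level_subgroup i.+1.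
  have Nu : level i (gap W j) by case: redW => h _ _; exact: h.
  have frj : far_from (level i) s (rho (prefix_prod W j)^-1%g @` A).
    move=> g _ lg [x Ax <-]; have := fr (prefix_prod W j * g)%g x.
    rewrite actM -[d (rho _ (rho g p)) _](isom_actP rho (prefix_prod W j)^-1%g) actVK.
    by apply=> //; apply: lM => //; exact: level_mono.
  rewrite /departure /arrival actM -(proj_dist_act rho (prefix_prod W j)^-1%g) !actVK.
  have fA' := spin_act spin (prefix_prod W j)^-1%g fA.
  have [si|si] := leP s (i%:R * T + rho0 + 2 * c).
    have := pr _ s _ Nu fA' ltac:(lra) si frj; rewrite /F; lra.
  have := level_proj_far conv Nu fA' si frj; rewrite /F; lra.
move=> u z q /level_succ/(reducedP (level_subgroup i))[W [m [redW <-]]] zq.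
have lv := chain_in_level redW; have [_ lM lV] := level_subgroup i.+1.
case: (chain_near (level_subgroup i) gD T_ge0 Lam_chain redW zq)
    => [[j jm zj]|[j [h [jm rh zh]]]].
  have Nu : level i (gap W j) by case: redW => h _ _; exact: h.
  have [v lvv zv] : exists2 v, level i v &
      d (rho (prefix_prod W j)^-1%g z) (rho v p) <= (q + 14 * c) / 2 + i%:R * T + rho0.
    apply: conv Nu _; rewrite -(detour_act rho (prefix_prod W j)) actKV -actM.
    exact: zj.
  exists (prefix_prod W j * v)%g.
    by apply: lM; [exact: (lv j jm).1 | exact: level_mono].
  move: zv; rewrite -(isom_actP rho (prefix_prod W j)) actKV -actM; lra.
have lh : level i.+1 h.
  set k := (prefix_prod W j * gap W j)%g; have lk : level i.+1 k := (lv j (ltnW jm)).2.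
  rewrite -(unconj h k).
  apply: (lM _ _ _ (lV _ lk)); apply: (lM _ _ lk); apply: sub_generated.
  case: redW => _ /(_ _ jm)[fY _ _ _ [Yy yt]] _.
  exists (axis W j), (mark W j); split=> //; last by lra.
  have fZ := spin_act spin k fY.
  by have := spin_conj spin k^-1%g fZ rh; rewrite invgK act_imageV.
case: zh => zh; [exists (h * (prefix_prod W j * gap W j))%g | exists (h * prefix_prod W j.+1)%g].
- by apply: lM => //; exact: (lv j (ltnW jm)).2.
- by rewrite actM; move: zh; rewrite /arrival; lra.
- by apply: lM => //; exact: (lv j.+1 jm).1.
- by rewrite actM; move: zh; rewrite /departure; lra.
Qed.

Lemma level_all i : level_proj i /\ level_convex i.
Proof.
have [? [? ?]] := consts.
elim: i => [|i [pr conv]]; last exact: level_step.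
split.
  move=> u s A /level0 -> fA _ sl _; rewrite act1 proj_distxx; last exact: fam_nonempty.
  by lra.
move=> u z q /level0 ->; rewrite act1 => zq; exists 1%g; first exact: generated1.
move: zq; rewrite act1 /detour mdistxx mul0r (metric_sym p z); lra.
Qed.

(** A nontrivial element w belongs to level i + 1 but not to level i for some i, so
    a reduced word for it contains at least one pivot, and p and w p are far apart
    as seen from this pivot. *)
Theorem spinning_displacement w :
  generated [set h | exists2 A, fam A & rot A h] w -> w <> 1%g -> M < d p (rho w p).
Proof.
have [cp [? ?]] := consts.
move=> gw w1; have [i] : exists i, level i w.
  elim: gw {w1} => [|s h [A fA rs] _ [i li]]; first by exists 0%N; exact: generated1.
  have [y Ay] := fam_nonempty fA.
  pose k := (Num.truncn (d p y / T)).+1.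
  have mono a e g : level a g -> level (a + e) g.
    by elim: e => [|e IH] lg; rewrite ?addn0 // addnS; apply: level_mono; exact: IH.
  exists (i + k)%N; have [_ lM _] := level_subgroup (i + k); apply: lM; last exact: mono.
  rewrite addnC; apply: mono; apply: sub_generated; exists A, y; split=> //.
  have Tp : 0 < T by lra.
  by rewrite -ltr_pdivrMr // /k; exact: truncnS_gt.
elim: i => [/level0 //|i IH lw].
have [pr conv] := level_all i; have gD u A := @level_gapD i u A pr.
have [W [m [redW ew]]] := reducedP (level_subgroup i) (level_succ lw).
case: m => [|m] in redW ew.
  by apply: IH; rewrite -ew /wprod /= mul1g; case: redW => h _ _; exact: h.
have := chain_large (level_subgroup i) gD T_ge0 Lam_chain redW (ltn0Sn m).
have Z0 := chain_nonempty redW (ltn0Sn m).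
have := proj_dist_le_mdist p (arrival W m.+1) Z0.
by rewrite /arrival -/(wprod W m.+1) ew; lra.
Qed.

End Spinning.

(** * Integer powers *)

Section IntegerPowers.
Variable G : groupType.
Local Open Scope group_scope.
Implicit Types (g f : G) (i j : int) (n : nat).

Lemma expgzS g i : expgz g (i + 1)%R = expgz g i * g.
Proof.
case: i => n.
  have -> : (Posz n + 1)%R = Posz n.+1 by lia.
  exact: expgSr.
case: n => [|n].
  have -> : (Negz 0 + 1)%R = 0%R by lia.
  by rewrite /= expg1 mulVg.
have -> : (Negz n.+1 + 1)%R = Negz n by lia.
by rewrite /= (expgS g n.+1) invgM mulgVK.
Qed.

Lemma expgzD g i j : expgz g (i + j)%R = expgz g i * expgz g j.
Proof.
have pos k n : expgz g (k + Posz n)%R = expgz g k * expgz g n.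
  elim: n => [|n IH]; first by rewrite addr0 mulg1.
  have -> : (k + Posz n.+1)%R = (k + Posz n + 1)%R by lia.
  by rewrite expgzS IH -mulgA -[in RHS]addn1 PoszD expgzS.
case: j => n; first exact: pos.
have := pos (i + Negz n)%R n.+1; have -> : (i + Negz n + Posz n.+1)%R = i by lia.
by move=> ->; rewrite /= mulgK.
Qed.

Lemma expgzN g i : expgz g (- i)%R = (expgz g i)^-1.
Proof.
by apply: (mulgI (expgz g i)); rewrite -expgzD addrN mulgV.
Qed.

Lemma expgzJ f g i : f * expgz g i * f^-1 = expgz (f * g * f^-1) i.
Proof.
have pos n : f * g ^+ n * f^-1 = (f * g * f^-1) ^+ n.
  elim: n => [|n IH]; first by rewrite !expg0 mulg1 mulgV.
  by rewrite !expgSr -IH !mulgA mulgVK.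
case: i => n; first exact: pos.
by rewrite /= -pos !invgM invgK mulgA.
Qed.

Lemma expgzM g i j : expgz g (i * j)%R = expgz (expgz g i) j.
Proof.
have pos n : expgz g (i * Posz n)%R = expgz (expgz g i) n.
  elim: n => [|n IH]; first by rewrite mulr0.
  have -> : (i * Posz n.+1)%R = (i * n + i)%R by lia.
  by rewrite expgzD IH /= expgSr.
case: j => n; first exact: pos.
have -> : (i * Negz n)%R = (- (i * Posz n.+1))%R by lia.
by rewrite expgzN pos.
Qed.

Lemma expgz_conjM f g i j k : f * expgz g i * f^-1 = expgz g j ->
  f * expgz g (i * k)%R * f^-1 = expgz g (j * k)%R.
Proof. by move=> h; rewrite !expgzM expgzJ h. Qed.

End IntegerPowers.

(** * The axis of a loxodromic element *)

Section Axis.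
Variables (R : realType) (X : metricType R) (G : groupType).
Variable rho : isometric_action G X.
Variables (gam : G) (p : X).
Local Notation d := (@mdist R X).

Definition displacement (n : nat) : R := d p (rho (gam ^+ n)%g p).
Local Notation a := displacement.

Definition axis_point (i : int) : X := rho (expgz gam i) p.
Local Notation x_ := axis_point.

Definition axis_points : set X := range axis_point.

Lemma axis_point_shift i j : rho (expgz gam i) (x_ j) = x_ (i + j).
Proof. by rewrite /x_ expgzD actM. Qed.

Lemma mdist_axis i j : d (x_ i) (x_ j) = a `|i - j|%N.
Proof.
have half (n : nat) (k : int) : d (x_ k) (x_ (k + n)) = a n.
  rewrite -axis_point_shift -[x_ k](_ : rho (expgz gam k) p = _) //.
  by rewrite isom_actP.
case: (leP i j) => ij.
  have -> : j = i + `|i - j|%N by lia.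
  by rewrite half; congr a; lia.
have -> : i = j + `|i - j|%N by lia.
by rewrite metric_sym half; congr a; lia.
Qed.

Lemma mdist_axisE i j n : `|i - j|%N = n -> d (x_ i) (x_ j) = a n.
Proof. by rewrite mdist_axis => ->. Qed.

Lemma displacement0 : a 0 = 0.
Proof. by rewrite /a expg0 act1 mdistxx. Qed.

Lemma displacement_ge0 n : 0 <= a n.
Proof. exact: mdist_ge0. Qed.

Lemma displacementD m n : a (m + n) <= a m + a n.
Proof.
have := metric_triangle (x_ 0) (x_ m) (x_ (m + n)%N).
rewrite (@mdist_axisE 0 (m + n)%N (m + n)); last lia.
rewrite (@mdist_axisE 0 m m); last lia.
by rewrite (@mdist_axisE m (m + n)%N n) //; lia.
Qed.

Lemma displacement_le n : a n <= n%:R * a 1.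
Proof.
elim: n => [|n IH]; first by rewrite displacement0 mul0r.
by have := displacementD n 1; rewrite addn1 -natr1; lra.
Qed.

(** The second step of the orbit still moves away from p, by a margin of several
    delta; by a local-to-global argument this persists along the whole orbit. *)
Section LocalToGlobal.
Variables (delta : R).
Hypotheses (delta0 : 0 <= delta) (hyp : four_point X delta).
Hypothesis long : a 1 + 7 * delta + 2 <= a 2.

Let e := 2 * a 1 - a 2.

(** By induction the path from x_0 reaches x_n from the side of x_(n-1), and x_(n+1)
    lies on the other side. *)
Lemma displacement_step n : a n + a 1 - a n.+1 <= e + 2 * delta.
Proof.
have d0 := delta0; have lg := long; have := displacementD 1 1; rewrite /= => a11.
elim: n => [|n IH]; first by rewrite displacement0 /e; lra.
have := detour_insert hyp (x_ n) (x_ 0) (x_ n.+2) (x_ n.+1).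
rewrite /detour (@mdist_axisE n n.+1 1); last lia.
rewrite (@mdist_axisE n.+1 0 n.+1); last lia.
rewrite (@mdist_axisE n 0 n); last lia.
rewrite (@mdist_axisE 0 n.+1 n.+1); last lia.
rewrite (@mdist_axisE n.+1 n.+2 1); last lia.
rewrite (@mdist_axisE n n.+2 2); last lia.
rewrite (@mdist_axisE 0 n.+2 n.+2); last lia.
by move: IH; rewrite /e => IH []; lra.
Qed.

(** All Gromov products of points of the orbit, taken at points between them, are
    bounded: the orbit is a quasi-geodesic. *)
Lemma displacement_superadditive i j : a i + a j <= a (i + j) + (a 1 + 1 + 2 * delta).
Proof.
have d0 := delta0; have lg := long.
case: j => [|j]; first by rewrite addn0 displacement0; have := displacement_ge0 1; lra.
have := detour_insert hyp (x_ 0) (x_ (i + j.+1)%N) (x_ i.+1) (x_ i).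
rewrite /detour (@mdist_axisE 0 i i); last lia.
rewrite (@mdist_axisE i (i + j.+1)%N j.+1); last lia.
rewrite (@mdist_axisE 0 (i + j.+1)%N (i + j.+1)); last lia.
rewrite (@mdist_axisE i i.+1 1); last lia.
rewrite (@mdist_axisE 0 i.+1 i.+1); last lia.
rewrite (@mdist_axisE (i + j.+1)%N i j.+1); last lia.
rewrite (@mdist_axisE (i + j.+1)%N i.+1 j); last lia.
by have := displacement_step i; have := displacement_step j; rewrite /e => ? ? []; lra.
Qed.

Lemma displacement_linear n : n%:R <= a n.
Proof.
have d0 := delta0; have lg := long.
elim: n => [|n IH]; first by rewrite displacement0.
by have := displacement_step n; rewrite -natr1 /e; lra.
Qed.

(** A nearly closest point of the orbit is a gate: if the path from x to some x_k left
    the orbit elsewhere, the neighbour towards x_k would be closer to x. *)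
Lemma axis_gated : gated (a 1 + 1 + 2 * delta) axis_points.
Proof.
have d0 := delta0; have lg := long.
move=> x; pose E := [set d x (x_ i) | i in setT].
have hE : has_inf E.
  split; first by exists (d x (x_ 0)), 0.
  by exists 0 => _ [i _ <-]; exact: mdist_ge0.
have [_ [j _ <-] dj] := inf_adherent (@ltr01 R) hE.
have jmin i : d x (x_ j) <= d x (x_ i) + 1.
  have : inf E <= d x (x_ i) by apply: (ge_inf hE.2); exists i.
  by lra.
exists (x_ j); split; first by exists j.
move=> _ [k _ <-].
suff step i : `|j - i|%N = 1%N -> `|k - j|%N = (`|k - i|%N).+1 ->
    d x (x_ j) + d (x_ j) (x_ k) <= d x (x_ k) + (a 1 + 1 + 2 * delta).
  case: (ltgtP k j) => [kj|jk|->].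
  - by apply: (step (j - 1)); lia.
  - by apply: (step (j + 1)); lia.
  - by rewrite mdistxx; have := displacement_ge0 1; lra.
move=> ji ki; have := detour_insert hyp x (x_ k) (x_ i) (x_ j).
rewrite /detour (metric_sym (x_ k) (x_ j)) !mdist_axis ji.
have -> : `|j - k|%N = (`|k - i|%N).+1 by lia.
have := displacement_step `|k - i|%N; have := jmin i; rewrite /e => ? ? []; lra.
Qed.

End LocalToGlobal.

Section Coarse.
Variable c : R.
Hypotheses (c0 : 0 < c) (hyp : four_point X c) (gated_axis : gated c axis_points).
Hypothesis a_super : forall i j, a i + a j <= a (i + j) + c.
Hypothesis a_linear : forall n, n%:R <= a n.

Lemma axis_invariant i : rho (expgz gam i) @` axis_points = axis_points.
Proof.
apply/seteqP; split=> [_ [_ [j _ <-] <-]|_ [j _ <-]].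
  by exists (i + j) => //; rewrite axis_point_shift.
exists (x_ (j - i)); first by exists (j - i).
by rewrite axis_point_shift; congr x_; lia.
Qed.

Lemma displacement_mono m n : (m <= n)%N -> a m <= a n + c.
Proof.
move=> mn; have := a_super m (n - m); rewrite subnKC // => h.
by have := displacement_ge0 (n - m); lra.
Qed.

Lemma axis_translation x i :
  a `|i|%N - c <= proj_dist axis_points x (rho (expgz gam i) x).
Proof.
have [_ [[j _ <-] gx]] := gated_axis x.
have := proj_dist_translation (axis_invariant i) (conj (ex_intro2 _ _ j I erefl) gx).
by rewrite axis_point_shift mdist_axis; have -> : `|(j - (i + j))%R|%N = `|i|%N by lia.
Qed.

(** The orbit of f p under gam^m stays at constant distance from the axis and is
    itself part of a translate of the axis.  Between two of its points that are
    far apart any path follows the axis, hence so does f p. *)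
Lemma parallel_close f m x' : (0 < m)%N ->
  (f * expgz gam m * f^-1)%g = expgz gam m \/
    (f * expgz gam m * f^-1)%g = expgz gam (- m%:Z) ->
  gate axis_points c (rho f p) x' -> d (rho f p) x' <= 5 * c.
Proof.
move=> m0 fm gx; set z := rho f p in gx *; have cp := c0.
pose k := (Num.truncn (4 * c)).+1; pose q := (m%:Z * k%:Z)%R.
have kq : 4 * c < a `|q|%N.
  apply: lt_le_trans (truncnS_gt _) _; apply: le_trans (a_linear _).
  rewrite ler_nat /q -/k; have : (k <= m * k)%N by rewrite leq_pmull.
  lia.
have near i : `|i|%N = `|q|%N -> exists y', [/\ gate axis_points c (rho (expgz gam i) z) y'
    & d z x' + d x' y' + d y' (rho (expgz gam i) z) - 4 * c <= d z (rho (expgz gam i) z)].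
  move=> iq; have [y' gy] := gated_axis (rho (expgz gam i) z); exists y'; split=> //.
  apply: (proj_dist_through hyp (lexx c) gx gy).
  by have := axis_translation z i; rewrite iq; lra.
have [y [gy dy]] := near q erefl.
have [w [gw dw]] := near (- q) (abszN q).
have ends : detour (rho (expgz gam q) z) z (rho (expgz gam (- q)) z) <= c.
  have fz i j : (f * expgz gam i * f^-1)%g = expgz gam j -> rho (expgz gam j) z = rho f (x_ i).
    by move=> <-; rewrite /z /x_ -!actM mulgVK.
  suff [q1 [q2 [e1 e2 e3 e4]]] : exists q1 q2, [/\ `|q1|%N = `|q|%N, q2 = - q1,
      rho (expgz gam q) z = rho f (x_ q1) & rho (expgz gam (- q)) z = rho f (x_ q2)].
    rewrite e3 e4 /z -[p](act1 rho) -[1%g](expg0 gam) -[(gam ^+ 0)%g]/(expgz gam 0).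
    rewrite -/(x_ 0) detour_act /detour !mdist_axis.
    have -> : `|q1 - 0|%N = `|q|%N by lia.
    have -> : `|0 - q2|%N = `|q|%N by lia.
    have -> : `|q1 - q2|%N = (`|q| + `|q|)%N by lia.
    by have := a_super `|q|%N `|q|%N; lra.
  case: fm => fm.
    exists q, (- q); split=> //; apply: fz; first exact: (expgz_conjM k%:Z fm).
    by have := expgz_conjM (- k%:Z) fm; rewrite mulrN.
  exists (- q), q; split; rewrite ?opprK ?abszN //; apply: fz.
    by have := expgz_conjM (- k%:Z) fm; rewrite mulrNN mulrN.
  by have := expgz_conjM k%:Z fm; rewrite mulNr.
move: ends; rewrite /detour.
have := metric_triangle (rho (expgz gam q) z) y (rho (expgz gam (- q)) z).
have := metric_triangle y w (rho (expgz gam (- q)) z).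
have := metric_triangle y x' w; have := metric_sym y x'; have := metric_sym x' z.
have := metric_sym (rho (expgz gam q) z) y; have := metric_sym (rho (expgz gam q) z) z.
by lra.
Qed.

(** Conjugate powers have the same asymptotic translation length, which grows with
    the exponent. *)
Lemma conj_power_le f (q q' : int) : (f * expgz gam q * f^-1)%g = expgz gam q' ->
  (`|q'| <= `|q|)%N.
Proof.
move=> fq; rewrite leqNgt; apply/negP => qq'; have cp := c0.
pose n := (Num.truncn (c + 2 * d p (rho f p))).+1.
have := expgz_conjM n%:Z fq => /(congr1 (fun g => d p (rho g p))).
have -> : d p (rho (expgz gam (q' * n%:Z)) p) = a (`|q'| * n)%N.
  by rewrite -[p in mdist p _](act1 rho) (mdist_axis 0); congr a; lia.
rewrite actM actM => eqd.
have h1 : a (`|q'| * n)%N <= a (`|q| * n)%N + 2 * d p (rho f p).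
  rewrite -eqd.
  have <- : d p (rho (expgz gam (q * n%:Z)) p) = a (`|q| * n)%N.
    by rewrite -[p in mdist p _](act1 rho) (mdist_axis 0); congr a; lia.
  set g := expgz _ _.
  have := metric_triangle p (rho f p) (rho f (rho g (rho f^-1%g p))).
  rewrite isom_actP; have := metric_triangle p (rho g p) (rho g (rho f^-1%g p)).
  rewrite isom_actP; have := isom_actP rho f p (rho f^-1%g p); rewrite actKV.
  by rewrite (metric_sym _ p); lra.
have h2 := a_super (`|q| * n) ((`|q'| - `|q|) * n).
have h3 : n%:R <= a ((`|q'| - `|q|) * n).
  by apply: le_trans (a_linear _); rewrite ler_nat leq_pmull // subn_gt0.
have := truncnS_gt (c + 2 * d p (rho f p)); rewrite -/n.
move: h2; rewrite -mulnDl subnKC 1?ltnW //; lra.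
Qed.

(** Between the gates of two points of f axis the axis is close to a path joining
    them, and so to f axis. *)
Lemma fellow_travel f z1 z2 (k l t : int) : axis_points z1 -> axis_points z2 ->
  gate axis_points c (rho f z1) (x_ k) -> gate axis_points c (rho f z2) (x_ l) ->
  3 * c < proj_dist axis_points (rho f z1) (rho f z2) -> k <= t -> t <= l ->
  exists s, d (x_ t) (rho f (x_ s)) <= 4 * c.
Proof.
move=> z1A z2A g1 g2 D kt tl.
have := proj_dist_through hyp (lexx c) g1 g2 D.
have [_ [[_ [s _ <-] <-] gs]] := gated_act rho f gated_axis (x_ t).
exists s; have i1 : (rho f @` axis_points) (rho f z1) by exists z1.
have i2 : (rho f @` axis_points) (rho f z2) by exists z2.
have gt : gate (rho f @` axis_points) c (x_ t) (rho f (x_ s)).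
  by split=> //; exists (x_ s) => //; exists s.
have := gate_detour gt i1 i2; rewrite /detour.
have := metric_triangle (rho f z1) (x_ k) (x_ t).
have := metric_triangle (x_ t) (x_ l) (rho f z2).
have : d (x_ k) (x_ l) + c >= d (x_ k) (x_ t) + d (x_ t) (x_ l).
  rewrite !mdist_axis; have -> : `|k - l|%N = (`|k - t| + `|t - l|)%N by lia.
  exact: a_super.
have cp := c0; lra.
Qed.

Variable n0 : nat.
Hypothesis F_finite : finite_set [set h | d p (rho h p) <= 8 * c /\
  d (rho (gam ^+ n0)%g p) (rho h (rho (gam ^+ n0)%g p)) <= 8 * c].

(** Let s t be the position on f axis of a point close to x_t.  The elements
    eta t = gam^(-t) f gam^(s t) almost fix p and carry gam^e p near gam^n0 p, where
    the increment e = s (t + n0) - s t takes boundedly many values.  Quotients of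
    two such elements with equal increments lie in the finite set provided by weak
    proper discontinuity, so eta t = eta t' for some t <> t', which means that f
    conjugates a power of gam to the power t - t'. *)
Lemma wpd_pigeonhole : exists N : nat, forall (f : G) (k : int) (s : int -> int),
  (forall t, k <= t -> t <= k + N%:Z + n0%:Z -> d (x_ t) (rho f (x_ (s t))) <= 4 * c) ->
  exists q q' : int, [/\ (0 < `|q'|)%N, (`|q'| <= N)%N &
    (f * expgz gam q * f^-1)%g = expgz gam q'].
Proof.
have cp := c0.
have [F eF] := (finite_seqP _).1 F_finite.
pose K := (Num.truncn (a n0 + 8 * c)).+1.
pose N := (K.*2.+1 * size F)%N; exists N => f k s sP.
pose tm (i : 'I_N.+1) : int := k + (i : nat)%:Z.
pose et t := s (t + n0%:Z) - s t.
pose eta t := (expgz gam (- t) * f * expgz gam (s t))%g.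
have tm_in i : k <= tm i /\ tm i <= k + N%:Z + n0%:Z /\
    tm i + n0%:Z <= k + N%:Z + n0%:Z.
  by rewrite /tm; case: i => i /= iN; lia.
have et_small i : (`|et (tm i)| <= K)%N.
  have [h1 [h2 h3]] := tm_in i; rewrite -(@ler_nat R); apply: le_trans (a_linear _) _.
  apply: le_trans (ltW (truncnS_gt _)).
  have -> : a `|et (tm i)|%N = d (rho f (x_ (s (tm i + n0%:Z)))) (rho f (x_ (s (tm i)))).
    by rewrite isom_actP mdist_axis.
  have := metric_triangle (rho f (x_ (s (tm i + n0%:Z)))) (x_ (tm i + n0%:Z))
    (rho f (x_ (s (tm i)))).
  have := metric_triangle (x_ (tm i + n0%:Z)) (x_ (tm i)) (rho f (x_ (s (tm i)))).
  rewrite (@mdist_axisE (tm i + n0%:Z) (tm i) n0); last lia.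
  have := sP _ h1 h2; have := sP (tm i + n0%:Z) ltac:(lia) h3.
  by rewrite (metric_sym (x_ (tm i + n0%:Z)) (rho f (x_ (s (tm i + n0%:Z))))); lra.
have ecode_lt i : (`|(et (tm i) + K%:Z)%R| < K.*2.+1)%N by have := et_small i; lia.
pose ecode i := Ordinal (ecode_lt i).
have ecode_eq i j : ecode i = ecode j -> et (tm i) = et (tm j).
  by move=> /(congr1 val) /=; have := et_small i; have := et_small j; lia.
(* A fixed representative among the indices with the same increment. *)
pose rep i := odflt i [pick j | ecode j == ecode i].
have repE i : ecode (rep i) = ecode i.
  by rewrite /rep; case: pickP => [j /eqP //|].
have rep_eq i j : ecode i = ecode j -> rep i = rep j.
  rewrite /rep => ->; case: pickP => // /(_ j); by rewrite eqxx.
have etaF i : (eta (tm i) * (eta (tm (rep i)))^-1)%g \in F.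
  have moves t : k <= t -> t <= k + N%:Z + n0%:Z -> d p (rho (eta t) p) <= 4 * c.
    move=> h1 h2; rewrite -(isom_actP rho (expgz gam t)) -actM /eta !mulgA -expgzD addrN.
    by rewrite [expgz gam 0]expg0 mul1g actM; exact: sP.
  have moves' t : k <= t -> t + n0%:Z <= k + N%:Z + n0%:Z ->
      d (x_ n0) (rho (eta t) (x_ (et t))) <= 4 * c.
    move=> h1 h2; rewrite -(isom_actP rho (expgz gam t)) axis_point_shift -actM /eta.
    rewrite !mulgA -expgzD addrN [expgz gam 0]expg0 mul1g actM axis_point_shift.
    have -> : s t + et t = s (t + n0%:Z) by rewrite /et addrC subrK.
    by apply: sP => //; lia.
  have [h1 [h2 h3]] := tm_in i; have [h4 [h5 h6]] := tm_in (rep i).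
  have : [set` F] (eta (tm i) * (eta (tm (rep i)))^-1)%g; last by [].
  rewrite -eF /=; split.
    have := metric_triangle p (rho (eta (tm i)) p)
      (rho (eta (tm i) * (eta (tm (rep i)))^-1)%g p).
    have := moves _ h1 h2; have := moves _ h4 h5.
    rewrite actM isom_actP.
    by rewrite -(isom_actP rho (eta (tm (rep i))) p (rho (eta (tm (rep i)))^-1%g p)) actKV
      (metric_sym (rho (eta (tm (rep i))) p) p); lra.
  have := metric_triangle (x_ n0) (rho (eta (tm i)) (x_ (et (tm i))))
      (rho (eta (tm i) * (eta (tm (rep i)))^-1)%g (x_ n0)).
  have := moves' _ h1 h3; have := moves' _ h4 h6; rewrite (ecode_eq _ _ (repE i)).
  rewrite actM isom_actP.
  rewrite -(isom_actP rho (eta (tm (rep i))) _ (rho (eta (tm (rep i)))^-1%g _)) actKV.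
  by rewrite (metric_sym (rho _ (x_ (et _))) (x_ n0)) -/(x_ n0%:Z); lra.
have code_lt i : (index (eta (tm i) * (eta (tm (rep i)))^-1)%g F < size F)%N.
  by rewrite index_mem.
pose code i : 'I_K.*2.+1 * 'I_(size F) := (ecode i, Ordinal (code_lt i)).
have : ~~ injectiveb code.
  apply/negP => /injectiveP /leq_card.
  by rewrite card_prod !card_ord /N ltnn.
case/injectivePn => i [j ij cij].
have eij : ecode i = ecode j := congr1 fst cij.
have /= hij := congr1 (fun x => val x.2) cij.
have eqF : (eta (tm i) * (eta (tm (rep i)))^-1)%g = (eta (tm j) * (eta (tm (rep j)))^-1)%g.
  by rewrite -(nth_index 1%g (etaF i)) hij nth_index.
move: eqF; rewrite (rep_eq i j eij) => /mulIg eqF.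
exists (s (tm i) - s (tm j)), (tm i - tm j); split.
- have ijn : (i : nat) <> j by move=> /val_inj eqij; move: ij; rewrite eqij eqxx.
  by rewrite /tm; lia.
- by rewrite /tm; case: (i) (j) => /= i' ? [/= j' ?]; lia.
have := congr1 (fun g => expgz gam (tm i) * g * expgz gam (- s (tm j)) * f^-1)%g eqF.
rewrite /eta !mulgA -!expgzD addrN [expgz gam 0]expg0 mul1g => eqG.
have -> : (f * expgz gam (s (tm i) - s (tm j)) * f^-1)%g =
   (f * expgz gam (s (tm i)) * expgz gam (- s (tm j)) * f^-1)%g by rewrite expgzD !mulgA.
rewrite eqG -[(_ * expgz gam (s (tm j)) * _)%g]mulgA -expgzD addrN.
by rewrite [expgz gam 0]expg0 mulg1 mulgK.
Qed.

(** The exponent q' found by the pigeonhole principle depends on f, but it is at most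
    N, so N! serves for all f; the exponents on both sides agree up to sign by
    [conj_power_le]. *)
Lemma wpd_parallel : exists2 m : nat, (0 < m)%N & exists2 B : R, 0 <= B &
  forall f z1 z2, axis_points z1 -> axis_points z2 ->
    B < proj_dist axis_points (rho f z1) (rho f z2) ->
    (f * expgz gam m * f^-1)%g = expgz gam m \/
    (f * expgz gam m * f^-1)%g = expgz gam (- m%:Z).
Proof.
have cp := c0; have [N NP] := wpd_pigeonhole.
exists N`!; first exact: fact_gt0.
exists ((N + n0)%:R * a 1 + 3 * c).
  have h : 0 <= (N + n0)%:R * a 1 by rewrite mulr_ge0 // displacement_ge0.
  by lra.
have ordered f z1 z2 k l : axis_points z1 -> axis_points z2 ->
    gate axis_points c (rho f z1) (x_ k) -> gate axis_points c (rho f z2) (x_ l) ->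
    (N + n0)%:R * a 1 + 3 * c < proj_dist axis_points (rho f z1) (rho f z2) -> k <= l ->
    (f * expgz gam N`! * f^-1)%g = expgz gam N`! \/
    (f * expgz gam N`! * f^-1)%g = expgz gam (- (N`!)%:Z).
  move=> A1 A2 g1 g2 D kl.
  have a1 : 0 <= (N + n0)%:R * a 1 by rewrite mulr_ge0 // displacement_ge0.
  have long : (N + n0 < `|k - l|)%N.
    rewrite ltnNge; apply/negP => kln.
    have := proj_dist_gate_le g1 g2; rewrite mdist_axis.
    have := displacement_le `|k - l|.
    have : `|k - l|%N%:R * a 1 <= (N + n0)%:R * a 1.
      by rewrite ler_wpM2r ?ler_nat // displacement_ge0.
    by lra.
  have /choice[s sP] : forall t, exists s, k <= t -> t <= l -> d (x_ t) (rho f (x_ s)) <= 4 * c.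
    move=> t; have [[kt tl]|nt] := pselect (k <= t /\ t <= l).
      have D3 : 3 * c < proj_dist axis_points (rho f z1) (rho f z2) by lra.
      by have [s ?] := fellow_travel A1 A2 g1 g2 D3 kt tl; exists s.
    by exists 0 => kt tl; case: nt.
  have [|q [q' [q'0 q'N fq]]] := NP f k s.
    by move=> t kt tl; apply: sP => //; lia.
  have fq' : (f^-1 * expgz gam q' * f^-1^-1)%g = expgz gam q.
    by rewrite -fq invgK !mulgA mulVg mul1g mulgVK.
  have qq : `|q|%N = `|q'|%N.
    by apply/eqP; rewrite eqn_leq (conj_power_le fq) (conj_power_le fq').
  have [e eN] := dvdnP (dvdn_fact (n := N) (m := `|q'|) ltac:(by rewrite q'0)).
  have := expgz_conjM (e%:Z * Num.sg q) fq.
  have -> : q * (e%:Z * Num.sg q) = N`!%:Z by rewrite eN; lia.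
  have [-> ->|->] : (q' = q \/ q' = - q) by lia.
    by left; congr expgz; rewrite eN; lia.
  by move=> ->; right; congr expgz; rewrite eN; lia.
move=> f z1 z2 A1 A2 D.
have [_ [[k _ <-] g1]] := gated_axis (rho f z1).
have [_ [[l _ <-] g2]] := gated_axis (rho f z2).
have G1 : gate axis_points c (rho f z1) (x_ k) by split=> //; exists k.
have G2 : gate axis_points c (rho f z2) (x_ l) by split=> //; exists l.
case: (leP k l) => kl; first exact: (ordered f z1 z2 k l).
by apply: (ordered f z2 z1 l k) => //; [rewrite proj_dist_sym|exact: ltW].
Qed.

(** * The spinning family of an axis *)

Section Family.
Variables (m : nat) (B : R).
Hypotheses (m0 : (0 < m)%N) (B0 : 0 <= B).

Definition elementary : set G := [set f |
  (f * expgz gam m * f^-1)%g = expgz gam m \/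
  (f * expgz gam m * f^-1)%g = expgz gam (- m%:Z)].

Hypothesis wpdP : forall f z1 z2, axis_points z1 -> axis_points z2 ->
  B < proj_dist axis_points (rho f z1) (rho f z2) -> elementary f.

Lemma elementaryJ f k : elementary f ->
  exists k' : int, `|k'|%N = `|k|%N /\
    (f * expgz gam (m%:Z * k) * f^-1)%g = expgz gam (m%:Z * k').
Proof.
case=> h; have := expgz_conjM k h => ->; first by exists k.
by exists (- k); split; [exact: abszN | rewrite mulrN mulNr].
Qed.

Lemma elementary_subgroup : subgroup elementary.
Proof.
split.
- by left; rewrite mul1g invg1 mulg1.
- have comp f g : (f * g * expgz gam m * (f * g)^-1)%g =
      (f * (g * expgz gam m * g^-1) * f^-1)%g by rewrite invgM !mulgA.
  move=> f g Ef Eg; rewrite /elementary /= comp; case: Eg => ->; first exact: Ef.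
  rewrite expgzN; have -> : (f * (expgz gam m)^-1 * f^-1)%g =
      (f * expgz gam m * f^-1)^-1%g by rewrite !invgM invgK mulgA.
  by case: Ef => ->; [right | left; rewrite expgzN invgK].
- move=> f Ef; have inv g k : (f * g * f^-1)%g = k -> (f^-1 * k * f^-1^-1)%g = g.
    by move=> <-; rewrite invgK !mulgA mulVg mul1g mulgVK.
  case: Ef => /inv h; first by left.
  right; rewrite expgzN in h *.
  by rewrite -[in RHS]h !invgM !invgK mulgA.
Qed.

Lemma power_elementary i : elementary (expgz gam i).
Proof. by left; rewrite -expgzN -!expgzD; congr expgz; lia. Qed.

(** The orbit of p under [elementary] instead of the orbit under gam, so that the
    translates of the axis correspond exactly to the cosets of [elementary]; by
    [parallel_close] the two orbits are uniformly close. *)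
Definition base_axis : set X := [set rho f p | f in elementary].

Lemma axis_sub : axis_points `<=` base_axis.
Proof. by move=> _ [i _ <-]; exists (expgz gam i) => //; exact: power_elementary. Qed.

Lemma base_axis_close u : base_axis u -> exists2 v, axis_points v & d u v <= 5 * c.
Proof.
move=> [f Ef <-]; have [x' gx] := gated_axis (rho f p).
by exists x'; [exact: gx.1 | exact: (parallel_close m0 Ef gx)].
Qed.

Lemma base_axis_gate x x' : gate axis_points c x x' -> gate base_axis (11 * c) x x'.
Proof.
move=> [Ax gx]; split; first exact: axis_sub.
move=> u /base_axis_close[v Av uv]; have := gx _ Av.
have := metric_triangle x u v; have := metric_triangle x' v u.
by have := metric_sym u v; lra.
Qed.

Lemma base_axis_gated : gated (11 * c) base_axis.
Proof. by move=> x; have [x' gx] := gated_axis x; exists x'; exact: base_axis_gate. Qed.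

Lemma base_axis_invariant f : elementary f -> rho f @` base_axis = base_axis.
Proof.
have [_ EM EV] := elementary_subgroup.
move=> Ef; apply/seteqP; split=> [_ [_ [g Eg <-] <-]|_ [g Eg <-]].
  by exists (f * g)%g; [exact: EM | exact: actM].
exists (rho (f^-1 * g)%g p); first by exists (f^-1 * g)%g => //; apply: EM => //; exact: EV.
by rewrite -actM mulVKg.
Qed.

(** A translate of the axis equal to it has unbounded projection to it. *)
Lemma elementary_stabilizer f : rho f @` base_axis = base_axis -> elementary f.
Proof.
move=> fA; have cp := c0; pose n := (Num.truncn (B + 13 * c)).+1.
have in0 i : axis_points (x_ i) by exists i.
apply: (wpdP (in0 0) (in0 n)).
have close i : exists2 v, axis_points v & d (rho f (x_ i)) v <= 5 * c.
  by apply: base_axis_close; rewrite -fA; exists (x_ i) => //; apply: axis_sub.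
have [v0 A0 d0] := close 0; have [v1 A1 d1] := close n%:Z.
have [y0 g0] := gated_axis (rho f (x_ 0)); have [y1 g1] := gated_axis (rho f (x_ n)).
have := proj_dist_gate_ge g0 g1; have := g0.2 _ A0; have := g1.2 _ A1.
have := metric_triangle (rho f (x_ 0)) y0 (rho f (x_ n)).
have := metric_triangle y0 y1 (rho f (x_ n)); rewrite isom_actP mdist_axis.
have := truncnS_gt (B + 13 * c); rewrite -/n; have := a_linear n.
have -> : `|0 - n%:Z|%N = n by lia.
have := mdist_ge0 y0 v0; have := mdist_ge0 y1 v1.
by have := metric_sym y1 (rho f (x_ n)); lra.
Qed.

Variable L : nat.
Hypotheses (L0 : (0 < L)%N) (mL : (m %| L)%N).

Let LE : exists2 e : nat, L = (m * e)%N & (0 < e)%N.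
Proof. by have [e eL] := dvdnP mL; exists e; lia. Qed.

Definition axis_family : set (set X) := [set A | exists f, A = rho f @` base_axis].

(** The union over all f representing the axis; since [elementary] normalizes
    the powers of gam^m, one representative gives all of it
    ([axis_rotationsE]). *)
Definition axis_rotations (A : set X) : set G := [set h | exists f k,
  A = rho f @` base_axis /\ h = (f * expgz gam (L%:Z * k) * f^-1)%g].

Lemma rotations_elementaryJ f k : elementary f ->
  exists2 k' : int, `|k'|%N = `|k|%N &
    (f * expgz gam (L%:Z * k) * f^-1)%g = expgz gam (L%:Z * k').
Proof.
move=> Ef; have [e eL e0] := LE.
have [q [qk hq]] := elementaryJ 1 Ef; have := expgz_conjM (e%:Z * k) hq.
have -> : m%:Z * 1 * (e%:Z * k) = L%:Z * k by rewrite eL; lia.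
move=> ->; exists (q * k); first by rewrite abszM qk mul1n.
by congr expgz; rewrite eL; lia.
Qed.

Lemma axis_rotationsE f h : axis_rotations (rho f @` base_axis) h ->
  exists k, h = (f * expgz gam (L%:Z * k) * f^-1)%g.
Proof.
move=> [f' [k [eA ->]]].
have Ef : elementary (f^-1 * f')%g.
  by apply: elementary_stabilizer; rewrite act_imageM -eA act_imageV.
have [k' _ hk] := rotations_elementaryJ k Ef; exists k'; rewrite -hk.
by rewrite invgM invgK !mulgA mulgV mul1g mulgK.
Qed.

(** The scale is the displacement of gam^L, while the constant does not depend on
    L. *)
Lemma axis_spinning_family :
  spinning_family rho (B + 22 * c) (a L) axis_family axis_rotations.
Proof.
have cp := c0; have b0 := B0.
have Lpow k : elementary (expgz gam (L%:Z * k)) by exact: power_elementary.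
split.
- move=> _ [f ->]; apply: gated_act => x.
  have [x' [Ax gx]] := base_axis_gated x; exists x'; split=> // u Au.
  by have := gx _ Au; lra.
- by move=> g _ [f ->]; exists (g * f)%g; rewrite act_imageM.
- move=> _ _ x y [f ->] [g ->] fg [u Au <-] [v Av <-].
  rewrite -[rho g u](actKV rho f) -[rho g v](actKV rho f) proj_dist_act -!actM.
  set h := (f^-1 * g)%g; rewrite leNgt; apply/negP => D; apply: fg.
  have Eh : elementary h.
    have [u0 Au0 uu] := base_axis_close Au; have [v0 Av0 vv] := base_axis_close Av.
    apply: (wpdP Au0 Av0).
    have A1 : base_axis !=set0 by exists u.
    have A0 : axis_points !=set0 by exists u0.
    have [x' gx] := gated_axis (rho h u); have [y' gy] := gated_axis (rho h v).
    have := proj_dist_gate_le (base_axis_gate gx) (base_axis_gate gy).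
    have := proj_dist_gate_ge gx gy.
    have := proj_dist_le_mdist (rho h u) (rho h u0) A0.
    have := proj_dist_le_mdist (rho h v0) (rho h v) A0; rewrite !isom_actP.
    have := proj_dist_triangle (rho h u) (rho h u0) (rho h v) A0.
    have := proj_dist_triangle (rho h u0) (rho h v0) (rho h v) A0.
    have := metric_sym v0 v; lra.
  by rewrite -[in RHS](mulVKg f g) -/h act_imageM (base_axis_invariant Eh).
- move=> _ [f ->]; split.
  + exists f, 0; split=> //; rewrite mulr0 [expgz gam 0]expg0.
    by rewrite mulg1 mulgV.
  + move=> _ _ /axis_rotationsE[k ->] /axis_rotationsE[l ->]; exists f, (k + l).
    by split=> //; rewrite mulrDr expgzD !mulgA mulgVK.
  + move=> _ /axis_rotationsE[k ->]; exists f, (- k).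
    by split=> //; rewrite mulrN expgzN !invgM invgK mulgA.
- move=> g _ _ [f ->] /axis_rotationsE[k ->]; exists (g * f)%g, k.
  by rewrite act_imageM invgM !mulgA.
- move=> _ _ [f ->] /axis_rotationsE[k ->].
  by rewrite !act_imageM act_imageV base_axis_invariant.
- move=> _ _ x [f ->] /axis_rotationsE[k ->] h1.
  pose y := rho f^-1%g x; have [y' gy] := base_axis_gated y.
  have -> : x = rho f y by rewrite actKV.
  rewrite -actM mulgVK actM proj_dist_act.
  have := proj_dist_translation (base_axis_invariant (Lpow k)) gy.
  have [e Ee ey] := gy.1.
  have [_ _ EV] := elementary_subgroup.
  have [k' kk hk] := rotations_elementaryJ k (EV _ Ee).
  have -> : d y' (rho (expgz gam (L%:Z * k)) y') = a (L * `|k|)%N.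
    rewrite -ey -(isom_actP rho e^-1%g) actVK -!actM.
    rewrite -[p in mdist p _](act1 rho) -[e in (_ * e)%g]invgK hk (mdist_axis 0).
    by congr a; rewrite -kk; lia.
  have k0 : (0 < `|k|)%N.
    rewrite lt0n absz_eq0; apply/negP => /eqP k0; apply: h1.
    by rewrite k0 mulr0 [expgz gam 0]expg0 mulg1 mulgV.
  have := displacement_mono (leq_pmulr L k0); lra.
- move=> _ _ _ [f ->] [x Ax <-] [y Ay <-].
  have [_ [i _ <-] xi] := base_axis_close Ax.
  have [_ [j _ <-] yj] := base_axis_close Ay.
  pose k := ((i - j) %/ L%:Z)%Z.
  exists (f * expgz gam (L%:Z * k) * f^-1)%g; first by exists f, k.
  rewrite -actM mulgVK actM isom_actP.
  set r := expgz gam _.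
  have := metric_triangle x (x_ i) (rho r y).
  have := metric_triangle (x_ i) (rho r (x_ j)) (rho r y).
  rewrite isom_actP (metric_sym (x_ j) y) /r axis_point_shift mdist_axis.
  set q := `| _ |%N; have qL : (q <= L)%N.
    have L0' := L0; have := divz_eq (i - j) L%:Z; rewrite -/k => ek.
    have := modz_ge0 (i - j) (d := L%:Z) ltac:(lia).
    have := ltz_pmod (i - j) (d := L%:Z) ltac:(lia).
    by rewrite /q; lia.
  have := displacement_mono qL; lra.
Qed.

End Family.
End Coarse.

End Axis.

(** * Normal subgroups with large displacement *)

Section Existence.
Variables (R : realType) (X : metricType R) (G : groupType).
Variable rho : isometric_action G X.
Local Notation d := (@mdist R X).

(** Otherwise the displacement of g^(2^k) would grow at most linearly in k, whereas
    it is at least linear in 2^k. *)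
Lemma doubling_gain (g : G) (p : X) (L C K : R) : 1 <= L -> 0 <= C -> 0 <= K ->
  (forall n, L^-1 * n%:R - C <= displacement rho g p n) ->
  exists2 n, (0 < n)%N & displacement rho g p n + K <= displacement rho g p (n + n).
Proof.
move=> L1 C0 K0 lin; set a := displacement rho g p in lin *.
have L0 : 0 < L by lra.
have [//|none] := pselect (exists2 n, (0 < n)%N & a n + K <= a (n + n)%N).
have gain n : (0 < n)%N -> a (n + n)%N <= a n + K.
  move=> n0; rewrite leNgt; apply/negP => h; apply: none; exists n => //; exact: ltW.
have dyadic k : a (2 ^ k)%N <= a 1%N + k%:R * K.
  elim: k => [|k IH]; first by rewrite mul0r addr0.
  have := gain (2 ^ k)%N; rewrite expn_gt0 /= => /(_ isT).
  by rewrite addnn -mul2n -expnS -natr1; lra.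
have a1 : 0 <= a 1%N by exact: displacement_ge0.
pose k := (Num.truncn (L * (C + a 1%N + 2 * K))).+2.
have kbig : L * (C + a 1%N + 2 * K) + 1 < k%:R.
  by have := truncnS_gt (L * (C + a 1%N + 2 * K)); rewrite /k -natr1; lra.
have sq : (k * k <= 2 ^ (k + k))%N.
  by rewrite expnD leq_mul // ltnW // ltn_expl.
have := lin (2 ^ (k + k))%N; have := dyadic (k + k)%N.
have h : L^-1 * (k * k)%:R <= L^-1 * (2 ^ (k + k))%:R.
  by rewrite ler_wpM2l ?ler_nat // invr_ge0 ltW.
have h2 : k%:R * (C + a 1%N + 2 * K + L^-1) <= L^-1 * (k * k)%:R.
  have -> : L^-1 * (k * k)%:R = k%:R * (L^-1 * k%:R) by rewrite natrM; ring.
  apply: ler_wpM2l => //; rewrite -(ler_pM2l L0).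
  rewrite mulrA divff ?gt_eqF // mul1r mulrDr divff ?gt_eqF //.
  exact: ltW.
have Li : 0 < L^-1 by rewrite invr_gt0.
have k1 : 1 <= k%:R :> R by rewrite ler1n.
have h3 : C + a 1%N <= k%:R * (C + a 1%N) by rewrite ler_peMl //; lra.
have h4 : 0 < k%:R * L^-1 by rewrite mulr_gt0 //; lra.
rewrite natrD; move: h h2 h3 h4; move: (_ * (k * k)%:R) (_ * (2 ^ (k + k))%:R) => P Q.
move: (a (2 ^ (k + k))%N) (a 1%N) (L^-1) (k%:R) => S s l r *; exfalso; lra.
Qed.

Lemma displacement_pow (g : G) (p : X) n k :
  displacement rho (g ^+ n)%g p k = displacement rho g p (n * k).
Proof. by rewrite /displacement -expgnA. Qed.

Lemma four_point_mono (c c' : R) : c <= c' -> four_point X c -> four_point X c'.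
Proof. by move=> cc' h x y z w; case: (h x y z w) => ?; [left|right]; lra. Qed.

(** The constant C' of the spinning family is known before the power of gam is
    chosen, so this power can be taken large enough in terms of C'; the displacement
    bound at p is then transported to q. *)
Theorem wpd_normal_subgroup (q : X) (M : R) :
  gromov_hyperbolic X -> wpd rho -> 0 <= M ->
  exists2 N : normal_subgroup G, infinite_set (normal_set N) &
    forall w, normal_set N w -> w <> 1%g -> M < d q (rho w q).
Proof.
move=> /hyperbolic_four_point[delta delta0 hyp] [_ [g [p [L [C [L1 C0 gL]]]]] wpdF] M0.
have [n n0 gain] : exists2 n, (0 < n)%N &
    displacement rho g p n + (7 * delta + 2) <= displacement rho g p (n + n).
  apply: (@doubling_gain g p L C) => //; first by lra.
  move=> n; have /andP[+ _] := gL 0 n%:Z.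
  rewrite (mdist_axisE rho g p (n := n)); last by lia.
  by rewrite -intr_norm -natr_absz; have -> : absz (0 - n%:Z) = n by lia.
pose gam := (g ^+ n)%g.
set a := displacement rho gam p.
have long : a 1 + 7 * delta + 2 <= a 2.
  by rewrite /a !displacement_pow muln1 muln2 -addnn; lra.
have lin := displacement_linear delta0 hyp long.
have a0 : 0 <= a 1 by exact: displacement_ge0.
pose c := a 1 + 1 + 2 * delta; have c0 : 0 < c by rewrite /c; lra.
have hypc : four_point X c by apply: four_point_mono hyp; rewrite /c; lra.
have gatc : gated c (axis_points rho gam p) := axis_gated delta0 hyp long.
have supc := displacement_superadditive delta0 hyp long.
have lox : loxodromic rho gam.
  exists p, (1 + a 1), 0; split=> // [|i j]; first by lra.
  rewrite subr0 addr0 (mdist_axis rho gam p) -/a -intr_norm -natr_absz.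
  set k := absz _; have := lin k; have := displacement_le rho gam p k; rewrite -/a.
  have k0 : 0 <= k%:R :> R by [].
  move=> h1 h2; apply/andP; split.
    apply: le_trans h2; rewrite ler_piMl // invf_le1; lra.
  by rewrite mulrDl mul1r mulrC; lra.
have r0 : 0 < 8 * c by lra.
have [n1 n10 Fin] := wpdF gam lox p _ r0.
have [m m0 [B B0 wpdP]] := wpd_parallel c0 hypc gatc supc lin Fin.
pose C' := B + 22 * c; pose M' := M + 2 * d p q.
have M'0 : 0 <= M' by rewrite /M'; have := mdist_ge0 p q; lra.
pose Lam := (m * (Num.truncn (1000 * C' + 2 * M')).+1)%N.
have Lam0 : (0 < Lam)%N by rewrite muln_gt0 m0.
have mLam : (m %| Lam)%N by rewrite dvdn_mulr.
have spin := axis_spinning_family c0 hypc gatc supc lin m0 B0 wpdP Lam0 mLam.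
have Lam_big : 1000 * C' + 2 * M' <= a Lam.
  apply: le_trans (lin Lam); apply: le_trans (ltW (truncnS_gt _)) _.
  by rewrite ler_nat leq_pmull.
have C'0 : 0 < C' by rewrite /C'; lra.
have hypC : four_point X C' by apply: four_point_mono hypc; rewrite /C'; lra.
have moves := spinning_displacement spin C'0 hypC p M'0 Lam_big.
set S := [set h | exists2 A, axis_family rho gam p m A &
  axis_rotations rho gam p m Lam A h] in moves.
have SV s : S s -> S s^-1%g.
  by move=> [A fA rs]; exists A => //; case: (spin_subgroup spin fA) => _ _; apply.
have SJ s k : S s -> S (k * s * k^-1)%g.
  move=> [A fA rs]; exists (rho k @` A); first exact: (spin_act spin).
  exact: (spin_conj spin).
have subS : subgroup (generated S).
  split; [exact: generated1|by move=> *; exact: generated_mul|].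
  by move=> s; exact: generated_inv.
exists (@NormalSubgroup G _ subS (fun k s => @generated_conj _ _ s k SJ)) => /=.
  move=> Sfin; apply: infinite_nat.
  pose f (k : nat) := expgz gam (Lam%:Z * k%:Z).
  have Sf k : generated S (f k).
    apply: sub_generated; exists (base_axis rho gam p m).
      by exists 1%g; rewrite act_image1.
    by exists 1%g, k%:Z; rewrite act_image1 invg1 mulg1 mul1g.
  have -> : [set: nat] = f @^-1` (generated S) by apply/seteqP; split=> // k _; exact: Sf.
  apply: finite_preimage => // k l _ _ fkl.
  have : mdist (axis_point rho gam p (Lam%:Z * k%:Z)) (axis_point rho gam p (Lam%:Z * l%:Z)) = 0.
    by rewrite /axis_point -/(f k) fkl mdistxx.
  rewrite mdist_axis; set e := absz _ => ae.
  have /eqP : e = 0%N.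
    by apply/eqP; rewrite -leqn0 -(ler_nat R); have := lin e; rewrite ae.
  rewrite /e absz_eq0 subr_eq0 => /eqP /mulfI kl.
  have Lz : Lam%:Z != 0 by rewrite eqz_nat -lt0n.
  by have [] := kl Lz.
move=> w /moves + w1 => /(_ w1); rewrite /M'.
have := metric_triangle p q (rho w p); have := metric_triangle q (rho w q) (rho w p).
by rewrite isom_actP (metric_sym q p); lra.
Qed.

End Existence.

(** * Growth in the quotient graph *)

Local Open Scope quotient_scope.

Lemma gdistP (Y : graph) (u v : vertex Y) n : connected_graph Y ->
  (gdist u v <= n)%N <-> exists2 k, (k <= n)%N & walk k u v.
Proof.
move=> conn; rewrite /gdist; case: pselect => [h|[]]; last first.
  by have [k uv] := conn u v; exists k; apply/asboolP.
case: ex_minnP => k /asboolP uv kmin; split=> [kn|[j jn /asboolP /kmin kj]].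
  by exists k.
exact: leq_trans kj jn.
Qed.

Section Growth.
Variables (G : groupType) (Y : graph) (a : graph_action G Y).

Variable N : normal_subgroup G.
Local Notation pi := (quotient_vertex a N).

Lemma walk_quotient n u v : walk n u v -> walk n (pi u) (pi v).
Proof.
elim=> [w|k e x y z xy _ IH]; first exact: walk0.
apply: (@walkS (quotient_graph a N) _ (\pi_(orbit_space (on_edge a) N) e) _ (pi y) _ _ IH).
by exists e, x, y.
Qed.

Lemma quotient_vertexP u v : pi u = pi v <-> exists2 k, normal_set N k & a k u = v.
Proof. exact: orbit_spaceP. Qed.

Lemma walk_lift n (U V : vertex (quotient_graph a N)) u : walk n U V -> U = pi u ->
  exists2 v, V = pi v & walk n u v.
Proof.
move=> UV; elim: UV u => [W|k e U' V' W [e' [x [y [_ ex ey xy]]]] _ IH] u eU.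
  by exists u => //; exact: walk0.
have [l Nl lx] : exists2 l, normal_set N l & a l x = u.
  by apply/quotient_vertexP; rewrite -eU -ex.
have eV : V' = pi (a l y) by rewrite -ey; apply/quotient_vertexP; exists l.
have [v eW lv] := IH _ eV; exists v => //; apply: walkS lv.
by rewrite -lx; exact: (joins_act a l xy).
Qed.

Hypothesis conn : connected_graph Y.

Lemma quotient_connected : connected_graph (quotient_graph a N).
Proof.
elim/quotW=> u; elim/quotW=> v; have [n uv] := conn u v.
by exists n; exact: walk_quotient.
Qed.

(** Lifting a walk shows that the ball is the image of the corresponding ball of G.
    Finiteness matters because the growth function of an infinite ball is 0. *)
Lemma quotient_ballP b n : proper_action a ->
  finite_set [set q : quotient N | (gdist (pi b) (quotient_action a N q (pi b)) <= n)%N].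
Proof.
move=> /(_ b n) fin.
apply: sub_finite_set (finite_image (\pi_(quotient N)) fin) => q /=.
elim/quotW: q => g; rewrite pi_orbit_space_act.
move=> /(gdistP _ _ _ quotient_connected)[k kn /walk_lift /(_ erefl)[v ev bv]].
have [l Nl lv] := (quotient_vertexP _ _).1 ev.
exists (l * g)%g; first by apply/gdistP => //; exists k => //; rewrite actM lv.
apply/quotientP; rewrite invgM -[X in (_ * X)%g]invgK; apply: normal_conj.
by case: (normal_subgroupP N) => _ _; apply.
Qed.

(** H embeds in the quotient, and walks project to walks of the same length. *)
Lemma growth_function_quotient (H : set G) b n : proper_action a -> subgroup H ->
  (forall h, H h -> normal_set N h -> h = 1%g) ->
  (growth_function a b H n <= growth_function (quotient_action a N) (pi b) setT n)%N.
Proof.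
move=> proper Hsub HN; rewrite /growth_function.
set A := [set h | _]; set Q := [set q | _].
have finA : finite_set A by apply: sub_finite_set (proper b n) => h [].
have finQ : finite_set Q by apply: sub_finite_set (quotient_ballP b n proper) => q [].
pose f (g : G) : (quotient N : groupType) := \pi_(quotient N) g.
have inj : {in fset_set A &, injective f}.
  move=> g h; rewrite !in_fset_set // !inE => -[Hg _] [Hh _] /quotientP gh.
  have [_ HM HV] := Hsub.
  by apply: (mulgI g^-1%g); rewrite mulVg (HN _ (HM _ _ (HV _ Hg) Hh) gh).
have card_image : #|` [fset f x | x in fset_set A]%fset| = #|` fset_set A|.
  by rewrite card_in_imfset.
rewrite -card_image; apply: fsubset_leq_card.
apply/fsubsetP => _ /imfsetP[g + ->]; rewrite /= in_fset_set // inE => -[Hg bg].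
rewrite in_fset_set // inE; split=> //.
rewrite /f /= pi_orbit_space_act; apply/(gdistP _ _ _ quotient_connected).
have [k kn bk] := (gdistP _ _ _ conn).1 bg; exists k => //; exact: walk_quotient.
Qed.

End Growth.

Lemma limn_esup_le (R : realType) (u v : (\bar R)^nat) :
  (forall n, (u n <= v n)%E) -> (limn_esup u <= limn_esup v)%E.
Proof.
move=> uv; apply: le_ereal_inf_tmp => _ [V FV <-].
apply: (@le_trans _ _ (ereal_sup [set u x | x in V])).
  by apply: ereal_inf_lbound; exists V.
apply: ge_ereal_sup => _ [n Vn <-]; apply: le_trans (uv n) _.
by apply: ereal_sup_ubound; exists n.
Qed.

Theorem proposition8p1 (R : realType) (G : groupType)
    (Y : graph) (a : graph_action G Y)
    (Yconnected : connected_graph Y)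
    (aproper : proper_action a)
    (acocompact : cocompact_action a)
    (atight : growth_tight R a)
    (X : metricType R) (rho : isometric_action G X)
    (Xhyperbolic : gromov_hyperbolic X)
    (rhowpd : wpd rho)
    (H : set G) (Hsubgroup : subgroup H)
    (Helliptic : elliptic rho H)
    (b : vertex Y) :
  (growth_rate R a b H < growth_rate R a b setT)%E.
Proof.
have [q [M HM]] := Helliptic.
have H1 : H 1%g by case: Hsubgroup.
have Hq h : H h -> mdist q (rho h q) <= M.
  by move=> Hh; apply: HM; [exists 1%g; rewrite ?act1|exists h].
have M0 : 0 <= M by apply: le_trans (Hq _ H1); exact: mdist_ge0.
have [N Ninf Nmove] := wpd_normal_subgroup q Xhyperbolic rhowpd M0.
apply: le_lt_trans (atight N Ninf b); apply: limn_esup_le => n.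
rewrite lee_fin; apply: ge0_ler_powR; rewrite ?nnegrE ?invr_ge0 //.
rewrite ler_nat; apply: growth_function_quotient => // h Hh Nh.
apply: contrapT => h1; have := Nmove h Nh h1.
by rewrite ltNge Hq.
Qed.
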